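(* Let $f_1,f_2\in H^{-1}(\Omega)$ satisfy $f_1\le f_2$ in the $H^{-1}(\Omega)$ sense, i.e. $(f_1,v)\le (f_2,v)$ for all non-negative $v\in H^1_0(\Omega)$. For $i=1,2$ let $u_i\in\mathcal V_0$ be a solution of $$(\kappa(x,u_i)u_i',v')=(f_i,v)\quad\text{for all } v\in\mathcal V_0 .$$ If $$\max_{0\le k\le n-1}|u_2(a_k)-u_2(a_{k+1})|<\frac{2k_\alpha}{L_0},$$ then $u_1\le u_2$ in $\Omega$.
   Context: $\Omega=(a,b)\subset\mathbb R$ is a bounded open interval with a subdivision $a=a_0<a_1<\dots<a_{n-1}<a_n=b$, not assumed uniform. $\mathcal V_0\subset H^1_0(\Omega)$ is the space of continuous functions on $[a,b]$ that are affine on each interval $(a_{k-1},a_k)$, $k=1,\dots,n$, and satisfy $v(a)=v(b)=0$. Here $(u,v)=\int_\Omega uv$ (understood as the duality pairing when one argument is in $H^{-1}(\Omega)$), and $v'=\mathrm dv/\mathrm dx$. The coefficient $\kappa:\Omega\times\mathbb R\to\mathbb R$ is a Carathéodory function (measurable in $x$ for each $s$, continuous in $s$ for a.e. $x$). There are constants $0<k_\alpha<k_\beta$ with $k_\alpha<\kappa(x,s)<k_\beta$ for all $s\in\mathbb R$ and a.e. $x\in\Omega$, and a constant $L_0>0$ with $|\kappa(x,s)-\kappa(x,t)|\le L_0|s-t|$ for all $s,t\in\mathbb R$ and a.e. $x\in\Omega$. The discrete equation is the finite element weak form of $-(\kappa(x,u)u')'=f$ in $\Omega$ with homogeneous Dirichlet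 boundary conditions. *)

(* Defs.v *)
From HB Require Import structures.
From mathcomp Require Import all_boot all_order all_algebra.
From mathcomp Require Import all_classical all_reals all_analysis.
Set Implicit Arguments.
Unset Strict Implicit.
Unset Printing Implicit Defensive.
Import Order.TTheory GRing.Theory Num.Theory.
Import numFieldNormedType.Exports.
Local Open Scope classical_set_scope.
Local Open Scope ring_scope.

(* [R] carries the Borel sigma-algebra by default; [lebesgueType R] is [R] with
   the Lebesgue (i.e. completed Borel) sigma-algebra, so that "measurable" below
   means Lebesgue measurable. *)
Notation lebesgueType R :=
  (caratheodory_type (@wlength R idfun)^*%mu).
Notation leb := (@completed_lebesgue_measure _).

Section sobolev.
Variables (R : realType) (Omega : set R).
Implicit Types (u g phi : R -> R).

(* C_c^infty(Omega); a test function is given by its extension by 0 to R. *)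
Definition test_function phi : Prop :=
  [/\ forall (n : nat) (x : R), derivable (derive1n n phi) x 1,
      compact (closure [set x | phi x != 0]) &
      closure [set x | phi x != 0] `<=` Omega].

Definition L2 u : Prop :=
  measurable_fun (Omega : set (lebesgueType R)) (u : lebesgueType R -> R) /\
  leb.-integrable Omega (fun x => (u x ^+ 2)%:E).

(* u is in H^1(Omega), with weak derivative g. The derivative is carried along
   as it is determined only up to a null set; likewise u itself matters only
   up to a null subset of Omega and outside Omega. *)
Definition H1 u g : Prop :=
  [/\ L2 u, L2 g &
      forall phi, test_function phi ->
        \int[leb]_(x in Omega) (u x * derive1 phi x) =
        - \int[leb]_(x in Omega) (g x * phi x)].

(* The H^1(Omega) norm of a function u with weak derivative g. *)
Definition H1norm u g : R :=
  Num.sqrt (\int[leb]_(x in Omega) (u x ^+ 2) +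
            \int[leb]_(x in Omega) (g x ^+ 2)).

(* H^1_0(Omega): the closure of C_c^infty(Omega) in H^1(Omega). *)
Definition H10 u : Prop :=
  exists g, H1 u g /\
    exists phi : nat -> R -> R,
      (forall k, test_function (phi k)) /\
      H1norm (u \- phi k) (g \- derive1 (phi k)) @[k --> \oo] --> (0 : R).

(* H^{-1}(Omega): bounded linear functionals on H^1_0(Omega). Boundedness forces
   f to agree on a.e. equal representatives; the values of f outside H^1_0(Omega)
   are irrelevant. *)
Definition Hm1 (f : (R -> R) -> R) : Prop :=
  (forall (c : R) u v, H10 u -> H10 v ->
     f (fun x => c * u x + v x) = c * f u + f v) /\
  (exists C : R, forall u g, H10 u -> H1 u g -> `|f u| <= C * H1norm u g).

Definition Hm1_le (f1 f2 : (R -> R) -> R) : Prop :=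
  forall v, H10 v ->
    {ae (leb : set (lebesgueType R) -> \bar R),
       forall x, Omega x -> 0 <= v x} ->
    f1 v <= f2 v.

Definition caratheodory_function (kappa : R -> R -> R) : Prop :=
  (forall s : R, measurable_fun (Omega : set (lebesgueType R))
                   (fun x : lebesgueType R => kappa x s)) /\
  {ae (leb : set (lebesgueType R) -> \bar R),
     forall x, Omega x -> continuous (kappa x)}.

End sobolev.

Section finite_elements.
Variables (R : realType) (a b : R) (n : nat) (node : nat -> R).
Implicit Types (u v : R -> R).

(* Only the values node 0, ..., node n are used. *)
Definition subdivision : Prop :=
  [/\ node 0%N = a, node n = b &
      forall k, (k < n)%N -> node k < node k.+1].

Definition V0 v : Prop :=
  [/\ {within `[a, b], continuous v},
      forall k, (k < n)%N -> exists c d : R,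
        forall x, x \in `]node k, node k.+1[ -> v x = c * x + d,
      v a = 0 & v b = 0].

(* derive1 u is the classical derivative, which for elements of V0 exists off the
   nodes and represents the weak derivative; its values at the nodes do not
   affect the integral. *)
Definition discrete_solution (kappa : R -> R -> R) (f : (R -> R) -> R) u : Prop :=
  V0 u /\
  forall v, V0 v ->
    \int[leb]_(x in `]a, b[) (kappa x (u x) * derive1 u x * derive1 v x) = f v.

End finite_elements.

(* Main.v *)
(* Let w = u1 - u2 and let v be the nodal interpolant of the indicator of
   [w > 0]. Testing with v gives int (k1 u1' - k2 u2') v' = f1 v - f2 v <= 0,
   where ki = kappa(x, ui) and
     k1 u1' - k2 u2' = k1 w' + (k1 - k2) u2'.
   The derivative of v vanishes except on the cells where w changes sign. There
   w' v' > 0, and |w| is bounded by the affine interpolant of its absolute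
   nodal values, so that the L0-term is bounded by
   L0 |u2(a_k) - u2(a_{k+1})| / 2 < ka times the integral of w' v': every such
   cell contributes a positive amount, hence there is none,
   and w(a) = 0 gives w <= 0 at all nodes.
   That v lies in H^1_0 is seen by smoothing each kink with x * step(x / e), step
   built from exp(-1/x), after contracting the nodes towards the midpoint;
   norm convergence and the weak derivative follow by dominated convergence. *)
Require Import Defs.
From HB Require Import structures.
From mathcomp Require Import all_boot all_order all_algebra.
From mathcomp Require Import all_classical all_reals all_analysis.
From mathcomp Require Import measurable_realfun ring lra.
Set Implicit Arguments.
Unset Strict Implicit.
Unset Printing Implicit Defensive.
Import Order.TTheory GRing.Theory Num.Theory.
Import numFieldNormedType.Exports.
Local Open Scope classical_set_scope.
Local Open Scope ring_scope.

(** * Smooth functions and a smooth ramp *)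

Section smooth_functions.
Variable R : realType.
Implicit Types (f g : R -> R) (p : {poly R}) (x y : R).

(** The derivative is peeled off from the front, so that every closure property below is one
    induction on the order, over all functions at once. *)
Fixpoint Cn (n : nat) f : Prop :=
  if n is m.+1 then (forall x, derivable f x 1) /\ Cn m (derive1 f) else True.

Definition smooth f := forall n, Cn n f.

Lemma CnW n f : Cn n.+1 f -> Cn n f.
Proof.
by elim: n f => // n IH f [df Cf]; split => //; exact: IH.
Qed.

Lemma smooth_derivable1n f n x : smooth f -> derivable (derive1n n f) x 1.
Proof.
move=> /(_ n.+1).
by elim: n f => [|n IH] f [df Cf] //; rewrite derive1Sn; exact: IH.
Qed.

Lemma smooth_derivable f x : smooth f -> derivable f x 1.
Proof. exact: (@smooth_derivable1n f 0). Qed.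

Lemma smooth_derive f : smooth f -> smooth (derive1 f).
Proof. by move=> sf n; have [] := sf n.+1. Qed.

Lemma smooth_continuous f : smooth f -> continuous f.
Proof.
move=> sf x; apply: differentiable_continuous.
exact/derivable1_diffP/smooth_derivable.
Qed.

Lemma is_derive_derive1 f g : (forall x, is_derive x 1 f (g x)) -> derive1 f = g.
Proof. by move=> fg; apply/funext => x; rewrite derive1E; apply: derive_val. Qed.

(** Exhibiting a derivative [g] replaces any computation of [derive1 f]; all closure lemmas go
    through this. *)
Lemma CnS n f g : (forall x, is_derive x 1 f (g x)) -> Cn n g -> Cn n.+1 f.
Proof.
move=> fg Cg; split; last by rewrite (is_derive_derive1 fg).
by move=> x; apply: ex_derive.
Qed.

Lemma Cn_is_derive n f x : Cn n.+1 f -> is_derive x 1 f (derive1 f x).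
Proof. by move=> [df _]; rewrite derive1E; exact/derivableP. Qed.

Lemma Cn_cst n (c : R) : Cn n (fun=> c).
Proof.
elim: n c => // n IH c.
by apply: (@CnS _ _ (fun=> 0)) => // x; exact: is_derive_cst.
Qed.

Lemma CnD n f g : Cn n f -> Cn n g -> Cn n (fun x => f x + g x).
Proof.
elim: n f g => // n IH f g Cf Cg.
apply: (@CnS _ _ (fun x => derive1 f x + derive1 g x)); last by case: Cf Cg => [? ?] []; auto.
move=> x; have := Cn_is_derive x Cf; have := Cn_is_derive x Cg.
by move=> gx fx; exact: is_deriveD.
Qed.

Lemma CnM n f g : Cn n f -> Cn n g -> Cn n (fun x => f x * g x).
Proof.
elim: n f g => // n IH f g Cf Cg.
apply: (@CnS _ _ (fun x => f x * derive1 g x + g x * derive1 f x)).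
  move=> x; have := Cn_is_derive x Cf; have := Cn_is_derive x Cg.
  by move=> gx fx; exact: is_deriveM.
(* In the product rule [f] and [g] reappear undifferentiated; [CnW] lowers their order to match the
   induction hypothesis. *)
by apply: CnD; apply: IH; (exact: CnW || by case: Cf; case: Cg).
Qed.

Lemma CnV n f : (forall x, f x != 0) -> Cn n f -> Cn n (fun x => (f x)^-1).
Proof.
move=> f0; elim: n => // n IH Cf.
(* The derivative of [1 / f] is written as a product containing [1 / f] itself, to which the
   induction hypothesis applies. *)
apply: (@CnS _ _ (fun x => - 1 * ((f x)^-1 * (f x)^-1 * derive1 f x))).
  move=> x; have fx := Cn_is_derive x Cf.
  have := is_deriveV (f0 x) fx.
  by rewrite mulN1r /GRing.scale/= expr2 invfM mulNr.
have IHf := IH (CnW Cf).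
apply: CnM; first exact: Cn_cst.
by apply: CnM; [exact: CnM|case: Cf].
Qed.

Lemma Cn_affine n f (c d : R) : Cn n f -> Cn n (fun x => f (c * x + d)).
Proof.
elim: n f => // n IH f Cf.
apply: (@CnS _ _ (fun x => c * derive1 f (c * x + d))); last first.
  by apply: CnM; [exact: Cn_cst|apply: IH; case: Cf].
move=> x; rewrite mulrC.
have faff : is_derive x 1 (fun x => c * x + d) c.
  by apply: is_derive_eq; rewrite /GRing.scale/=; ring.
have ff := Cn_is_derive (c * x + d) Cf.
exact: (@is_derive1_comp _ f (fun x => c * x + d)).
Qed.

Lemma smooth_cst (c : R) : smooth (fun=> c).
Proof. by move=> n; exact: Cn_cst. Qed.

Lemma smooth_id : smooth id.
Proof.
case=> // n; apply: (@CnS _ _ (fun=> 1)); exact: Cn_cst.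
Qed.

Lemma smoothD f g : smooth f -> smooth g -> smooth (fun x => f x + g x).
Proof. by move=> sf sg n; exact: CnD. Qed.

Lemma smoothM f g : smooth f -> smooth g -> smooth (fun x => f x * g x).
Proof. by move=> sf sg n; exact: CnM. Qed.

Lemma smoothV f : (forall x, f x != 0) -> smooth f ->
  smooth (fun x => (f x)^-1).
Proof. by move=> f0 sf n; exact: CnV. Qed.

Lemma smooth_affine f (c d : R) : smooth f -> smooth (fun x => f (c * x + d)).
Proof. by move=> sf n; exact: Cn_affine. Qed.

Lemma smoothB f g : smooth f -> smooth g -> smooth (fun x => f x - g x).
Proof.
move=> sf sg; under eq_fun do rewrite -mulN1r.
by apply: smoothD => //; apply: smoothM => //; exact: smooth_cst.
Qed.

Lemma smooth_sum n (F : nat -> R -> R) : (forall k, smooth (F k)) ->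
  smooth (fun x => \sum_(k < n) F k x).
Proof.
move=> sF; elim: n => [|n IH].
  by under eq_fun do rewrite big_ord0; exact: smooth_cst.
by under eq_fun do rewrite big_ord_recr /=; exact: smoothD.
Qed.

Lemma smoothP f x : smooth f -> is_derive x 1 f (derive1 f x).
Proof. by move=> /(_ 1%N); exact: Cn_is_derive. Qed.

(* exp(-1/x) times a polynomial in 1/x: this family is stable under derivation *)
Definition flat p x : R := if 0 < x then p.[x^-1] * expR (- x^-1) else 0.

(** With t = 1/x, the inequality exp t >= 1 + t^(i+1) / (i+1)! gives t^i exp(-t) <= (i+1)! x;
    summing over the monomials of [p] yields the constant. This controls [flat p] near 0. *)
Lemma flat_le p : exists C, forall x, `|flat p x| <= C * `|x|.
Proof.
exists (\sum_(i < size p) `|p`_i| * (i.+1)`!%:R) => x; rewrite /flat.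
have C0 : 0 <= \sum_(i < size p) `|p`_i| * (i.+1)`!%:R :> R.
  by apply: sumr_ge0 => i _; rewrite mulr_ge0.
case: ifPn => [x0|_]; last by rewrite normr0 mulr_ge0.
rewrite normrM [X in _ * X <= _]ger0_norm ?expR_ge0// expRN.
rewrite ler_pdivrMr ?expR_gt0// horner_coef [`|x|]gtr0_norm//.
rewrite (le_trans (ler_norm_sum _ _ _))// !mulr_suml ler_sum// => i _.
rewrite normrM -!mulrA ler_wpM2l// normrX [X in X ^+ _]gtr0_norm ?invr_gt0//.
rewrite -ler_pdivrMl ?ltr0n ?fact_gt0// -ler_pdivrMl//.
rewrite mulrCA -exprS mulrC.
rewrite (le_trans _ (expR_ge1Dxn i _)) ?invr_ge0 ?(ltW x0)//.
by rewrite lerDr.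
Qed.

(** With t = 1/x one has d/dx = - t^2 d/dt, which turns p(t) exp(-t) into t^2 (p - p')(t)
    exp(-t). *)
Lemma is_derive_flat p x :
  is_derive x 1 (flat p) (flat ('X^2 * (p - p^`())) x).
Proof.
have [x0|x0|->] := ltgtP x 0.
- rewrite /flat ltNge (ltW x0)/=.
  apply: (@near_eq_is_derive _ _ _ (fun=> 0)).
  near=> y; rewrite /flat ifF//; apply/negbTE; rewrite -leNgt ltW//.
  by near: y; exact: lt_nbhsl.
- rewrite {2}/flat x0.
  apply: (@near_eq_is_derive _ _ _ (fun y => p.[y^-1] * expR (- y^-1))) => //.
    near=> y; rewrite /flat ifT//.
    by near: y; exact: lt_nbhsr.
  have dV : is_derive x 1 (fun y : R => y^-1) (- (x^-1 ^+ 2)).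
    have x1 : id x != 0 by rewrite gt_eqF.
    by have := is_deriveV x1 (is_derive_id x 1); rewrite /GRing.scale/= mulr1 exprVn.
  have dp : is_derive x 1 (fun y : R => p.[y^-1]) ((- (x^-1 ^+ 2)) * p^`().[x^-1]).
    rewrite mulrC; apply: (@is_derive1_comp _ (horner p) (fun y : R => y^-1)).
  have dN : is_derive x 1 (fun y : R => - y^-1) (x^-1 ^+ 2).
    by apply: is_derive_eq; rewrite opprK.
  have de : is_derive x 1 (fun y : R => expR (- y^-1)) (expR (- x^-1) * x^-1 ^+ 2).
    exact: (@is_derive1_comp _ expR (fun y : R => - y^-1)).
  apply: is_derive_eq; rewrite /GRing.scale/= !hornerE/=; ring.
(* At 0 the difference quotient of [flat p] is [flat ('X * p)], which [flat_le] squeezes to 0. *)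
- rewrite {2}/flat ltxx.
  have [C HC] := flat_le ('X * p).
  suff d0 : h^-1 *: (flat p (h *: 1 + 0) - flat p 0) @[h --> (0 : R)^'] --> (0 : R).
    apply: DeriveDef; first by apply/cvg_ex; exists 0.
    exact/cvg_lim.
  have C0 : C * `|h| @[h --> (0 : R)^'] --> (0 : R).
    have H : C * `|h| @[h --> (0 : R)] --> (0 : R).
      rewrite -[X in _ --> X](mulr0 C).
      apply: cvgM; first exact: cvg_cst.
      by rewrite -[X in _ --> X](@normr0 R R); apply: cvg_norm; exact: cvg_id.
    by apply: (cvg_trans _ H); apply: cvg_fmap2; exact: nbhs_dnbhs.
  apply: (@squeeze_cvgr _ _ _ _ (fun h => - (C * `|h|)) (fun h => C * `|h|)) => //.
    apply: nearW => h; rewrite -ler_norml.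
    suff -> : h^-1 *: (flat p (h *: 1 + 0) - flat p 0) = flat ('X * p) h by [].
    rewrite addr0 /GRing.scale/= mulr1 /flat ltxx subr0.
    by case: ifP; rewrite ?mulr0// hornerM hornerX mulrA.
  by rewrite -[X in _ --> X]oppr0; exact: cvgN.
Unshelve. all: by end_near. Qed.

Lemma smooth_flat p : smooth (flat p).
Proof.
move=> n; elim: n p => // n IH p.
exact: (CnS (is_derive_flat p)).
Qed.

End smooth_functions.

(** * Smooth step and smooth ramp of adjustable width *)

Section soft_ramp.
Variable R : realType.
Implicit Types x e : R.

(** The classical smooth transition from 0 on x <= 0 to 1 on x >= 1; [flat 1] is exp(-1/x) extended
    by 0. *)
Definition smooth_step x : R := flat 1 x / (flat 1 x + flat 1 (1 - x)).

Lemma flat1_ge0 x : 0 <= flat 1 x.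
Proof. by rewrite /flat; case: ifP => // _; rewrite hornerC mul1r expR_ge0. Qed.

Lemma flat1_gt0 x : 0 < x -> 0 < flat 1 x.
Proof. by move=> x0; rewrite /flat x0 hornerC mul1r expR_gt0. Qed.

Lemma flat1_le0 x : x <= 0 -> flat 1 x = 0.
Proof. by move=> x0; rewrite /flat ltNge x0. Qed.

Lemma flat1D_gt0 x : 0 < flat 1 x + flat 1 (1 - x).
Proof.
have [x0|x0] := ltP 0 x; first by rewrite ltr_pwDl ?flat1_gt0 ?flat1_ge0.
by rewrite ltr_wpDl ?flat1_ge0// flat1_gt0//; lra.
Qed.

(** The derivative of the rescaled step is of order 1/e, but the factor [x] compensates it: the
    slope of the ramp stays bounded as the width [e] tends to 0. *)
Definition soft_ramp e x : R := x * smooth_step (e^-1 * x).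

Lemma smooth_soft_ramp e : smooth (soft_ramp e).
Proof.
have h1 : smooth (fun x : R => flat 1 (1 - x)).
  under eq_fun do rewrite addrC -mulN1r.
  by apply: smooth_affine; exact: smooth_flat.
have h2 : smooth smooth_step.
  apply: smoothM; first exact: smooth_flat.
  apply: smoothV; first by move=> x; rewrite gt_eqF// flat1D_gt0.
  by apply: smoothD => //; exact: smooth_flat.
apply: smoothM; first exact: smooth_id.
by under eq_fun do rewrite -[_ * _]addr0; exact: smooth_affine.
Qed.

Lemma soft_ramp_le0 e x : 0 < e -> x <= 0 -> soft_ramp e x = 0.
Proof.
move=> e0 x0; rewrite /soft_ramp /smooth_step flat1_le0 ?mul0r ?mulr0//.
by rewrite mulr_ge0_le0// invr_ge0 ltW.
Qed.

Lemma soft_ramp_ge e x : 0 < e -> e <= x -> soft_ramp e x = x.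
Proof.
move=> e0 ex; rewrite /soft_ramp /smooth_step [flat 1 (1 - _)]flat1_le0.
  rewrite addr0 divff ?mulr1// gt_eqF// flat1_gt0// mulr_gt0 ?invr_gt0//.
  exact: lt_le_trans ex.
by rewrite subr_le0 ler_pdivlMl// mulr1.
Qed.

Lemma soft_ramp_norm e x : `|soft_ramp e x| <= `|x|.
Proof.
rewrite /soft_ramp normrM ler_piMr// /smooth_step.
rewrite ger0_norm ?divr_ge0 ?flat1_ge0 ?(ltW (flat1D_gt0 _))//.
by rewrite ler_pdivrMr ?flat1D_gt0// mul1r lerDl flat1_ge0.
Qed.

Lemma soft_rampE e x : e != 0 -> soft_ramp e x = e * soft_ramp 1 (e^-1 * x).
Proof. by move=> e0; rewrite /soft_ramp invr1 mul1r !mulrA mulfV// mul1r. Qed.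

(** By the homogeneity [soft_rampE], the slope depends on x/e only. *)
Lemma derive1_soft_ramp e x : e != 0 ->
  derive1 (soft_ramp e) x = derive1 (soft_ramp 1) (e^-1 * x).
Proof.
move=> e0; rewrite [in LHS]derive1E.
have -> : soft_ramp e = e \*: (soft_ramp 1 \o *%R e^-1).
  by apply/funext => y /=; rewrite soft_rampE.
have ff := smoothP (e^-1 * x) (@smooth_soft_ramp 1).
have faff : is_derive x 1 ( *%R e^-1) e^-1.
  by apply: is_derive_eq; rewrite /GRing.scale/=; ring.
have fc := @is_derive1_comp _ (soft_ramp 1) ( *%R e^-1) _ _ _ ff faff.
have := is_deriveZ e fc => /@derive_val ->.
by rewrite /GRing.scale/= mulrC divfK.
Qed.

Lemma derive1_soft_ramp_lt0 e x : 0 < e -> x < 0 -> derive1 (soft_ramp e) x = 0.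
Proof.
move=> e0 x0; rewrite derive1E -[RHS](derive_cst (0 : R) x (1 : R)).
apply: near_eq_derive; near=> y; rewrite soft_ramp_le0// ltW//.
by near: y; exact: lt_nbhsl.
Unshelve. all: by end_near. Qed.

Lemma derive1_soft_ramp_gt e x : 0 < e -> e < x -> derive1 (soft_ramp e) x = 1.
Proof.
move=> e0 x0; rewrite derive1E -[RHS](derive_id x (1 : R)).
apply: near_eq_derive; near=> y; rewrite soft_ramp_ge// ltW//.
by near: y; exact: lt_nbhsr.
Unshelve. all: by end_near. Qed.

(** Scaling reduces to width 1, where the slope is continuous on [0, 1] and constant on either side;
    the maximum with 1 covers these constants 0 and 1. *)
Lemma derive1_soft_ramp_bounded :
  exists M, forall e x, 0 < e -> `|derive1 (soft_ramp e) x| <= M.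
Proof.
pose h x := `|derive1 (soft_ramp 1) x|.
have hc : continuous h.
  move=> x; apply: cvg_norm.
  exact: smooth_continuous (smooth_derive (@smooth_soft_ramp 1)) _.
have [c _ hM] := EVT_max (@ler01 R) (continuous_subspaceT hc).
exists (Num.max (h c) 1) => e x e0; rewrite derive1_soft_ramp ?gt_eqF//.
rewrite le_max; set y := _ * x.
have [y0|y0] := ltP y 0.
  by rewrite derive1_soft_ramp_lt0// normr0 ler01 orbT.
have [y1|y1] := ltP 1 y.
  by rewrite derive1_soft_ramp_gt// normr1 lexx orbT.
by apply/orP; left; apply: hM; rewrite in_itv/= y0.
Qed.

End soft_ramp.

(** * The completed Lebesgue measure *)

Section lebesgue_facts.
Variable R : realType.
Implicit Types (f g F : R -> R) (p q a b x : R).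

Lemma measurable_leb (A : set R) :
  measurable (A : set (measurableTypeR R)) -> measurable (A : set (lebesgueType R)).
Proof. exact: sub_caratheodory. Qed.

Lemma measurable_leb_itv (i : interval R) :
  measurable ([set` i] : set (lebesgueType R)).
Proof. by apply: measurable_leb; exact: measurable_itv. Qed.

Lemma measurable_leb_set1 p : measurable ([set p] : set (lebesgueType R)).
Proof. by apply: measurable_leb; exact: measurable_set1. Qed.

Lemma measurable_fun_leb (D : set R) f :
  measurable_fun (D : set (measurableTypeR R)) f ->
  measurable (D : set (measurableTypeR R)) ->
  measurable_fun (D : set (lebesgueType R)) (f : lebesgueType R -> R).
Proof. by move=> mf mD _ B mB; apply: measurable_leb; exact: mf. Qed.

Lemma continuous_measurable_leb (D : set R) f :
  measurable (D : set (lebesgueType R)) -> continuous f ->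
  measurable_fun (D : set (lebesgueType R)) (f : lebesgueType R -> R).
Proof.
move=> mD cf; apply: (@measurable_funS _ _ (lebesgueType R) R [set: lebesgueType R] D f) => //.
by apply: measurable_fun_leb => //; exact: continuous_measurable_fun.
Qed.

Lemma leb_itv p q : p <= q -> leb `]p, q[ = (q - p)%:E.
Proof.
(* Both measures restrict the same outer measure, so the Borel formula transfers after unfolding. *)
move=> pq; have := @lebesgue_measure_itv R `]p, q[.
rewrite /lebesgue_measure/= /completed_lebesgue_measure/= => /= H.
apply: (etrans H); rewrite lte_fin; case: ltP => // qp.
have -> : p = q by lra.
by rewrite subrr.
Qed.

Lemma leb_set1 p : leb [set p] = 0%E.
Proof. exact: (@lebesgue_measure_set1 R p). Qed.

Lemma leb_bounded_integrable a b f (M : R) :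
  measurable_fun (`]a, b[ : set (lebesgueType R)) (f : lebesgueType R -> R) ->
  (forall x, x \in `]a, b[ -> `|f x| <= M) ->
  leb.-integrable `]a, b[ (EFin \o f).
Proof.
move=> mf fM; apply: measurable_bounded_integrable => //.
- exact: measurable_leb_itv.
- have [ab|ba] := ltP a b; last first.
    by rewrite set_itv_ge ?measure0// -leNgt bnd_simp.
  by apply: le_lt_trans (ltry (b - a)); rewrite -(leb_itv (ltW ab)) lexx.
- exists M; split; first exact: num_real.
  by move=> y My x /= xab; rewrite (le_trans (fM _ xab))// ltW.
Qed.

Lemma continuous_bounded_itv a b f : continuous f ->
  exists M : R, forall x, x \in `]a, b[ -> `|f x| <= M.
Proof.
move=> cf.
have cfs : {within `[a, b], continuous f} by exact: continuous_subspaceT.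
have [M [_ fM]] : bounded_set (f @` `[a, b]).
  by apply: compact_bounded; apply: continuous_compact => //; exact: segment_compact.
exists (M + 1) => x xab; apply: (fM (M + 1)); first by rewrite ltrDl.
by exists x => //; exact: subset_itv_oo_cc.
Qed.

(** The identity is measurable from the Lebesgue to the Borel sigma-algebra; pushing the completed
    measure forward along it reduces the claim to the fundamental theorem of calculus for the Borel
    measure. *)
Lemma leb_integral_derive p q F f : p < q ->
  (forall x, is_derive x 1 F (f x)) -> continuous f ->
  (\int[leb]_(x in `]p, q[) f x)%R = F q - F p.
Proof.
move=> pq dF cf.
have mid : measurable_fun [set: lebesgueType R] (id : lebesgueType R -> measurableTypeR R).
  by move=> _ B mB; rewrite setTI; exact: measurable_leb.
have mf : measurable_fun [set: measurableTypeR R] (EFin \o f).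
  by apply/measurable_EFinP; exact: continuous_measurable_fun.
have cF : continuous F.
  by move=> x; apply: differentiable_continuous; apply/derivable1_diffP; case: (dF x).
have cfs : {within `[p, q], continuous f} by exact: continuous_subspaceT.
have [M fM] := continuous_bounded_itv p q cf.
have fint : leb.-integrable `]p, q[ (EFin \o f).
  apply: leb_bounded_integrable fM.
  by apply: continuous_measurable_leb => //; exact: measurable_leb_itv.
rewrite /Rintegral.
have mI : measurable (`]p, q[%classic : set (measurableTypeR R)) by exact: measurable_itv.
have := @integral_pushforward _ _ _ _ R _ mid leb _ _ mf fint mI.
rewrite (@eq_measure_integral _ _ _ _ (@lebesgue_measure R)) => [/esym/= ->|A mA _//].
rewrite integral_itv_bndo_bndc; last first.
  by apply/measurable_EFinP; apply: measurable_funTS; exact: continuous_measurable_fun.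
rewrite integral_itv_obnd_cbnd; last first.
  by apply/measurable_EFinP; apply: measurable_funTS; exact: continuous_measurable_fun.
rewrite (@continuous_FTC2 _ f F)//.
  split => [x _||]; first by case: (dF x).
  - by apply: cvg_at_right_filter; exact: cF.
  - by apply: cvg_at_left_filter; exact: cF.
by move=> x _; rewrite derive1E; case: (dF x).
Qed.

Lemma ae_leb_filter :
  Filter (almost_everywhere (leb : set (lebesgueType R) -> \bar R)).
Proof. exact: (@ae_filter_ringOfSetsType _ (lebesgueType R) R leb). Qed.

Lemma leb_dominated_convergence a b (f_ : nat -> R -> R) f (M : R) :
  (forall n, measurable_fun (`]a, b[ : set (lebesgueType R)) (f_ n : lebesgueType R -> R)) ->
  measurable_fun (`]a, b[ : set (lebesgueType R)) (f : lebesgueType R -> R) ->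
  {ae (leb : set (lebesgueType R) -> \bar R), forall x, x \in `]a, b[ ->
     f_ n x @[n --> \oo] --> f x} ->
  (forall n x, x \in `]a, b[ -> `|f_ n x| <= M) ->
  (\int[leb]_(x in `]a, b[) f_ n x)%R @[n --> \oo] -->
  (\int[leb]_(x in `]a, b[) f x)%R.
Proof.
move=> mf_ mf f_f fM.
have mI : measurable (`]a, b[%classic : set (lebesgueType R)) by exact: measurable_leb_itv.
have [|||||fi _ fc] := @dominated_convergence _ (lebesgueType R) R leb `]a, b[ mI
  (fun n => EFin \o f_ n) (EFin \o f) (fun=> M%:E).
- by move=> n; exact/measurable_EFinP.
- exact/measurable_EFinP.
- move: f_f; apply: (@filterS _ _ ae_leb_filter) => x H xab.
  by apply/cvg_EFin; [exact: nearW|exact: H].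
(* The sign of [M] is not known here, hence the absolute value as the bound. *)
- apply: (@leb_bounded_integrable _ _ (fun=> M) `|M|) => //.
- by apply: aeW => x n xab; rewrite /= lee_fin; exact: fM.
apply: fine_cvg; rewrite fineK//; exact: integrable_fin_num.
Qed.

(** The exceptional set removes [node k] for every natural number [k]: a countable union of null
    singletons. *)
Lemma ae_leb_off_nodes n (node : nat -> R) (P : R -> Prop) :
  (forall x, (forall k, (k <= n)%N -> x != node k) -> P x) ->
  {ae (leb : set (lebesgueType R) -> \bar R), forall x, P x}.
Proof.
move=> hP; have : (leb : set (lebesgueType R) -> \bar R).-negligible
    (\bigcup_k [set node k]).
  apply: negligible_bigcup => k; exists [set node k]; split => //.
  - exact: measurable_leb_set1.
  - exact: leb_set1.
apply: negligibleS => x /= nPx.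
apply: contrapT => nx; apply: nPx; apply: hP => k _.
by apply/eqP => xk; apply: nx; exists k.
Qed.

End lebesgue_facts.

(** * Piecewise affine functions belong to H^1_0 *)

Section piecewise.
Variables (R : realType) (n : nat) (s : nat -> R).
Implicit Types (r : R -> R) (node : nat -> R) (x : R).

(* With r the ramp [max(-, 0)] this is the piecewise affine function of slope
   s k between node k and node k.+1; with r the Heaviside function it is its
   derivative. *)
Definition stitch node r x : R :=
  \sum_(k < n) s k * (r (x - node k) - r (x - node k.+1)).

Definition ramp x : R := Num.max x 0.

Definition heaviside : R -> R := \1_(`]0, +oo[).

Lemma heaviside_gt0 x : 0 < x -> heaviside x = 1.
Proof. by move=> x0; rewrite /heaviside indicE mem_set//= in_itv/= x0. Qed.

Lemma heaviside_le0 x : x <= 0 -> heaviside x = 0.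
Proof.
by move=> x0; rewrite /heaviside indicE memNset//= in_itv/= andbT ltNge x0.
Qed.

Lemma heaviside_norm x : `|heaviside x| <= 1.
Proof.
have [x0|x0] := ltP 0 x; first by rewrite heaviside_gt0// normr1.
by rewrite heaviside_le0// normr0 ler01.
Qed.

Lemma ramp_ge0 x : 0 <= x -> ramp x = x.
Proof. by move=> x0; rewrite /ramp max_l. Qed.

Lemma ramp_le0 x : x <= 0 -> ramp x = 0.
Proof. by move=> x0; rewrite /ramp max_r. Qed.

Lemma ramp_norm x : `|ramp x| <= `|x|.
Proof.
have [x0|x0] := leP 0 x; first by rewrite ramp_ge0.
by rewrite ramp_le0 ?normr0 ?normr_ge0// ltW.
Qed.

Lemma ramp_continuous : continuous ramp.
Proof. by move=> x; apply: continuous_max; [exact: cvg_id|exact: cvg_cst]. Qed.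

Lemma stitch_norm node r x (B : R) :
  (forall k, (k <= n)%N -> `|r (x - node k)| <= B) ->
  `|stitch node r x| <= \sum_(k < n) `|s k| * (B + B).
Proof.
move=> rB; rewrite /stitch (le_trans (ler_norm_sum _ _ _))// ler_sum// => k _.
rewrite normrM ler_wpM2l// (le_trans (ler_normB _ _))// lerD// rB//.
exact: ltnW.
Qed.

(** Nodes and profile move together with [m], as they do in the mollification. *)
Lemma cvg_stitch (node_ : nat -> nat -> R) (r_ : nat -> R -> R) node r x :
  (forall k, (k <= n)%N -> r_ m (x - node_ m k) @[m --> \oo] --> r (x - node k)) ->
  stitch (node_ m) (r_ m) x @[m --> \oo] --> stitch node r x.
Proof.
move=> H; rewrite /stitch; apply: cvg_big => [|k _].
  by apply: add_continuous.
apply: cvgM; first exact: cvg_cst.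
by apply: cvgB; apply: H => //; exact: ltnW.
Qed.

Lemma continuous_stitch node r : continuous r -> continuous (stitch node r).
Proof.
move=> cr x.
have shift c : r (y - c) @[y --> x] --> r (x - c).
  have cs : {for x, continuous (fun y : R => y - c)}.
    by apply: cvgB; [exact: cvg_id|exact: cvg_cst].
  exact: (continuous_comp cs (cr _)).
rewrite /stitch; apply: cvg_big => [|k _]; first by apply: add_continuous.
apply: cvgM; first exact: cvg_cst.
exact: cvgB (shift _) (shift _).
Qed.

(** Where every profile acts as the identity, [x] cancels in each difference and only the total
    increment remains. *)
Lemma stitch_shift c node r x :
  (forall k, (k <= n)%N -> r (x - node k) = x - node k) ->
  \sum_(k < n) s k * (node k.+1 - node k) = c ->
  stitch node r x = c.
Proof.
move=> H <-; apply: eq_bigr => k _.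
by rewrite !H ?(ltnW (ltn_ord k))//; ring.
Qed.

Lemma stitch_eq0 node r x :
  (forall k, (k <= n)%N -> r (x - node k) = 0) -> stitch node r x = 0.
Proof.
by move=> H; apply: big1 => k _; rewrite !H ?(ltnW (ltn_ord k))// subrr mulr0.
Qed.

Lemma smooth_stitch node r : smooth r -> smooth (stitch node r).
Proof.
move=> sr.
have shift c : smooth (fun x => r (x - c)).
  by under eq_fun do rewrite -[X in X - _]mul1r; exact: smooth_affine.
apply: (@smooth_sum _ _ (fun k x => s k * (r (x - node k) - r (x - node k.+1)))).
by move=> k; apply: smoothM; [exact: smooth_cst|exact: smoothB].
Qed.

Lemma derive1_stitch node r : smooth r ->
  derive1 (stitch node r) = stitch node (derive1 r).
Proof.
move=> sr; apply: is_derive_derive1 => x.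
have shift c : is_derive x 1 (fun x => r (x - c)) (derive1 r (x - c)).
  have h1 := smoothP (x - c) sr.
  have h2 : is_derive x 1 (fun y : R => y - c) 1.
    by apply: is_derive_eq; rewrite subr0.
  by have := @is_derive1_comp _ r (fun y => y - c) _ _ _ h1 h2; rewrite mulr1.
have -> : stitch node r = \sum_(k < n) (fun x => s k * (r (x - node k) - r (x - node k.+1))).
  by apply/funext => y; rewrite fct_sumE.
exact: is_derive_sum.
Qed.

Lemma measurable_stitch node r (D : set (lebesgueType R)) :
  measurable D ->
  measurable_fun setT (r : measurableTypeR R -> R) ->
  measurable_fun D (stitch node r : lebesgueType R -> R).
Proof.
move=> mD mr; apply: (@measurable_funS _ _ (lebesgueType R) R setT) => //.
apply: measurable_fun_leb => //.
apply: (@measurable_sum _ _ _ _ _ _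
  (fun k x => s (k : 'I_n) * (r (x - node k) - r (x - node k.+1)))) => k.
apply: measurable_funM => //.
have shift c : measurable_fun setT ((fun x => r (x - c)) : measurableTypeR R -> R).
  apply: (measurableT_comp mr).
  apply: continuous_measurable_fun => x.
  by apply: cvgB; [exact: cvg_id|exact: cvg_cst].
exact: (measurable_funB (shift _) (shift _)).
Qed.

End piecewise.

(** * Smooth, compactly supported approximations of a piecewise affine function *)

Section H10_piecewise_affine.
Variables (R : realType) (a b : R) (n : nat) (node s : nat -> R).
Hypothesis ab : a < b.
Hypothesis node_ab : forall k, (k <= n)%N -> a <= node k <= b.
Hypothesis closed_up : \sum_(k < n) s k * (node k.+1 - node k) = 0.
Implicit Types (x : R) (k m : nat).

(* The nodes are contracted towards the midpoint of (a, b), which makes room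
   for the smoothing inside (a, b). *)
Definition margin m : R := 3^-1 * harmonic m.
Definition inner_node m k := (1 - 2 * margin m) * node k + margin m * (a + b).
(** Half of the gap that the contraction opens next to [b], so that the smoothing at the last node
    still ends before [b]. *)
Definition width m := margin m * (b - a) / 2.
Definition mollified m : R -> R :=
  stitch n s (inner_node m) (soft_ramp (width m)).

Lemma margin_gt0 m : 0 < margin m.
Proof. by rewrite mulr_gt0 ?invr_gt0// ltr0n. Qed.

(** The factor 1/3 in [margin] keeps [1 - 2 * margin m] positive, so the contraction preserves the
    order of the nodes. *)
Lemma margin_le m : margin m <= 3^-1.
Proof. by rewrite ler_piMr// /harmonic invf_le1 ?ltr0n// ler1n. Qed.

Lemma cvg_margin : margin m @[m --> \oo] --> (0 : R).
Proof.
rewrite -[X in _ --> X](mulr0 3^-1); apply: cvgM; first exact: cvg_cst.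
exact: cvg_harmonic.
Qed.

Lemma width_gt0 m : 0 < width m.
Proof. by rewrite /width divr_gt0// mulr_gt0 ?margin_gt0// subr_gt0. Qed.

Lemma inner_node_itv m k : (k <= n)%N ->
  a + margin m * (b - a) <= inner_node m k <= b - margin m * (b - a).
Proof.
move=> /node_ab /andP[ak kb]; have m0 := margin_gt0 m; have m3 := margin_le m.
have m2 : 0 <= 1 - 2 * margin m by lra.
have h1 : 0 <= (1 - 2 * margin m) * (node k - a) by rewrite mulr_ge0// subr_ge0.
have h2 : 0 <= (1 - 2 * margin m) * (b - node k) by rewrite mulr_ge0// subr_ge0.
by rewrite /inner_node; apply/andP; split; lra.
Qed.

Lemma cvg_inner_node k : inner_node m k @[m --> \oo] --> node k.
Proof.
have -> : node k = (1 - 2 * 0) * node k + 0 * (a + b) by ring.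
apply: cvgD; apply: cvgM; try exact: cvg_cst; last exact: cvg_margin.
apply: cvgB; first exact: cvg_cst.
by apply: cvgM; [exact: cvg_cst|exact: cvg_margin].
Qed.

Lemma cvg_width : width m @[m --> \oo] --> (0 : R).
Proof.
have -> : (0 : R) = 0 * (b - a) / 2 by ring.
by do 2 (apply: cvgM; last exact: cvg_cst); exact: cvg_margin.
Qed.

Lemma smooth_mollified m : smooth (mollified m).
Proof. by apply: smooth_stitch; exact: smooth_soft_ramp. Qed.

Lemma derive1_mollified m :
  derive1 (mollified m) = stitch n s (inner_node m) (derive1 (soft_ramp (width m))).
Proof. by rewrite derive1_stitch//; exact: smooth_soft_ramp. Qed.

Lemma mollified_left m x : x <= a + margin m * (b - a) -> mollified m x = 0.
Proof.
move=> xa; apply: stitch_eq0 => k /(inner_node_itv m)/andP[h _].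
by rewrite soft_ramp_le0 ?width_gt0//; lra.
Qed.

(** Beyond all smoothing zones the value is the total increment; the contraction merely multiplies
    it by [1 - 2 * margin m], and [closed_up] says that it is 0. *)
Lemma mollified_right m x : b - margin m * (b - a) / 2 <= x -> mollified m x = 0.
Proof.
move=> xb; apply: stitch_shift => [k /(inner_node_itv m)/andP[_ h]|].
  by rewrite soft_ramp_ge ?width_gt0// /width; lra.
transitivity ((1 - 2 * margin m) * \sum_(k < n) s k * (node k.+1 - node k)).
  by rewrite mulr_sumr; apply: eq_bigr => k _; rewrite /inner_node; ring.
by rewrite closed_up mulr0.
Qed.

Lemma test_function_mollified m : test_function `]a, b[ (mollified m).
Proof.
(* The thresholds of [mollified_left] and [mollified_right], both strictly inside (a, b). *)
pose c := a + margin m * (b - a); pose d := b - margin m * (b - a) / 2.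
have m0 : 0 < margin m * (b - a) by rewrite mulr_gt0 ?margin_gt0// subr_gt0.
have supp : closure [set x | mollified m x != 0] `<=` `[c, d].
  apply: (@subset_trans _ (closure `[c, d])).
    apply: closure_subset => x /= phi0; rewrite in_itv/=; apply/andP; split.
      by apply: contraNT phi0; rewrite -ltNge => /ltW/mollified_left ->.
    by apply: contraNT phi0; rewrite -ltNge => /ltW/mollified_right ->.
  have /closure_id <- // : closed `[c, d]%classic by exact: interval_closed.
split.
- by move=> j x; apply: smooth_derivable1n; exact: smooth_mollified.
- apply: (subclosed_compact _ (@segment_compact _ c d)) => //.
  exact: closed_closure.
- apply: (subset_trans supp) => x /=; rewrite !in_itv/= /c /d => /andP[cx xd].
  by apply/andP; split; lra.
Qed.

Lemma node_dist x k : x \in `]a, b[ -> (k <= n)%N -> `|x - node k| <= b - a.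
Proof.
rewrite in_itv/= => /andP[ax xb] /node_ab/andP[ak kb].
by rewrite ler_norml; apply/andP; split; lra.
Qed.

Lemma mollified_norm : exists M : R, forall m x, x \in `]a, b[ ->
  `|mollified m x| <= M.
Proof.
(* The witness is read off from [stitch_norm]; it involves neither [m] nor [x]. *)
eexists => m x xab; apply: (@stitch_norm _ _ _ _ _ _ (b - a)) => k kn.
apply: (le_trans (soft_ramp_norm _ _)).
have /andP[h1 h2] := inner_node_itv m kn.
have m0 : 0 < margin m * (b - a) by rewrite mulr_gt0 ?margin_gt0// subr_gt0.
move: xab; rewrite in_itv/= => /andP[ax xb].
by rewrite ler_norml; apply/andP; split; lra.
Qed.

Lemma derive1_mollified_norm : exists M : R, forall m x,
  `|derive1 (mollified m) x| <= M.
Proof.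
have [M HM] := derive1_soft_ramp_bounded R.
eexists => m x; rewrite derive1_mollified.
by apply: (@stitch_norm _ _ _ _ _ _ M) => k _; apply: HM; exact: width_gt0.
Qed.

(** The smoothing zone of each node shrinks to that node, so a point off the nodes eventually stays
    on one fixed side of it, where the soft ramp is exactly 0 or the identity. *)
Lemma cvg_mollified x : (forall k, (k <= n)%N -> x != node k) ->
  mollified m x @[m --> \oo] --> stitch n s node (@ramp R) x /\
  derive1 (mollified m) x @[m --> \oo] --> stitch n s node (@heaviside R) x.
Proof.
move=> xnode.
suff H k : (k <= n)%N ->
    soft_ramp (width m) (x - inner_node m k) @[m --> \oo] --> ramp (x - node k) /\
    derive1 (soft_ramp (width m)) (x - inner_node m k) @[m --> \oo] -->
      heaviside (x - node k).
  under [X in _ /\ X]eq_cvg do rewrite derive1_mollified.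
  by split; apply: cvg_stitch => k /H[].
move=> kn; have cx : x - inner_node m k @[m --> \oo] --> x - node k.
  by apply: cvgB; [exact: cvg_cst|exact: cvg_inner_node].
have [xk|kx] := ltP x (node k).
  have lt0 : \forall m \near \oo, x - inner_node m k < 0.
    by apply: (cvgr_lt _ cx); rewrite subr_lt0.
  rewrite ramp_le0 ?heaviside_le0 ?subr_le0 ?ltW//; split; apply: cvg_near_cst;
    apply: filterS lt0 => m lt0.
  - by rewrite soft_ramp_le0 ?width_gt0// ltW.
  - by rewrite derive1_soft_ramp_lt0 ?width_gt0.
have {}kx : node k < x by rewrite lt_neqAle kx eq_sym xnode.
(* The width is subtracted too, since the soft ramp is the identity only beyond its width. *)
have gt0 : \forall m \near \oo, 0 < x - inner_node m k - width m.
  have cw : x - inner_node m k - width m @[m --> \oo] --> x - node k - 0.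
    by apply: cvgB => //; exact: cvg_width.
  by apply: (cvgr_gt _ cw); rewrite subr0 subr_gt0.
rewrite ramp_ge0 ?heaviside_gt0 ?subr_gt0 ?subr_ge0 ?ltW//; split.
- apply: cvg_trans cx; apply: near_eq_cvg; apply: filterS gt0 => m gt0.
  by rewrite soft_ramp_ge ?width_gt0//; lra.
- apply: cvg_near_cst; apply: filterS gt0 => m gt0.
  by rewrite derive1_soft_ramp_gt ?width_gt0//; lra.
Qed.

Let v := stitch n s node (@ramp R).
Let g := stitch n s node (@heaviside R).

Lemma ae_cvg_mollified :
  {ae (leb : set (lebesgueType R) -> \bar R), forall x, x \in `]a, b[ ->
    mollified m x @[m --> \oo] --> v x /\
    derive1 (mollified m) x @[m --> \oo] --> g x}.
Proof.
by apply: (@ae_leb_off_nodes _ n node) => x xnode _; exact: cvg_mollified.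
Qed.

End H10_piecewise_affine.

(** * Passage to the limit in H^1 *)

Section H10_stitch.
Variables (R : realType) (a b : R) (n : nat) (node s : nat -> R).
Hypothesis ab : a < b.
Hypothesis node_ab : forall k, (k <= n)%N -> a <= node k <= b.
Hypothesis closed_up : \sum_(k < n) s k * (node k.+1 - node k) = 0.
Implicit Types (x : R) (k m : nat).

Let v := stitch n s node (@ramp R).
Let g := stitch n s node (@heaviside R).
Let phi := mollified a b n node s.
Notation I := (`]a, b[%classic : set (lebesgueType R)).

Let mI : measurable I. Proof. exact: measurable_leb_itv. Qed.

Let mv : measurable_fun I (v : lebesgueType R -> R).
Proof.
by apply: measurable_stitch => //; apply: continuous_measurable_fun; exact: ramp_continuous.
Qed.

Let mg : measurable_fun I (g : lebesgueType R -> R).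
Proof.
by apply: measurable_stitch => //; apply: measurable_indic; exact: measurable_itv.
Qed.

Let v_norm : exists M : R, forall x, x \in `]a, b[ -> `|v x| <= M.
Proof.
eexists => x xab; apply: (@stitch_norm _ _ _ _ _ _ (b - a)) => k kn.
by apply: (le_trans (ramp_norm _)); exact: node_dist xab kn.
Qed.

Let g_norm : exists M : R, forall x, `|g x| <= M.
Proof.
by eexists => x; apply: (@stitch_norm _ _ _ _ _ _ 1) => k _; exact: heaviside_norm.
Qed.

Let L2_bounded (u : R -> R) : measurable_fun I (u : lebesgueType R -> R) ->
  (exists M : R, forall x, x \in `]a, b[ -> `|u x| <= M) -> L2 `]a, b[ u.
Proof.
move=> mu [M uM]; split => //.
apply: (@leb_bounded_integrable _ _ _ (fun x => u x ^+ 2) (M ^+ 2)).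
  exact: measurable_funX.
by move=> x xab; rewrite normrX lerXn2r ?nnegrE ?uM// (le_trans (normr_ge0 _) (uM _ xab)).
Qed.

Let mphi m : measurable_fun I (phi m : lebesgueType R -> R).
Proof.
by apply: continuous_measurable_leb => //; apply: smooth_continuous; exact: smooth_mollified.
Qed.

Let mdphi m : measurable_fun I (derive1 (phi m) : lebesgueType R -> R).
Proof.
apply: continuous_measurable_leb => //; apply: smooth_continuous.
by apply: smooth_derive; exact: smooth_mollified.
Qed.

Let ae_cvg : {ae (leb : set (lebesgueType R) -> \bar R), forall x, x \in `]a, b[ ->
    phi m x @[m --> \oo] --> v x /\ derive1 (phi m) x @[m --> \oo] --> g x}.
Proof. exact: ae_cvg_mollified. Qed.

(** For each [m] the integral of the derivative of [phi m * psi] is 0, because [phi m] vanishes at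
    [a] and [b]. Uniform bounds and almost everywhere convergence carry this identity over to [v]
    and [g]. *)
Lemma weak_derivative_stitch (psi : R -> R) : test_function `]a, b[ psi ->
  (\int[leb]_(x in `]a, b[) (v x * derive1 psi x) =
   - \int[leb]_(x in `]a, b[) (g x * psi x))%R.
Proof.
move=> [dpsi _ _].
have is_dpsi x : is_derive x 1 psi (derive1 psi x).
  by rewrite derive1E; apply/derivableP; exact: (dpsi 0%N).
have cpsi : continuous psi.
  by move=> x; apply: differentiable_continuous; apply/derivable1_diffP; exact: (dpsi 0%N).
have cdpsi : continuous (derive1 psi).
  by move=> x; apply: differentiable_continuous; apply/derivable1_diffP; exact: (dpsi 1%N).
have [P psiP] := continuous_bounded_itv a b cpsi.
have [Q psiQ] := continuous_bounded_itv a b cdpsi.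
have [V vV] := v_norm; have [G gG] := g_norm.
have mpsi : measurable_fun I (psi : lebesgueType R -> R).
  exact: continuous_measurable_leb.
have mdpsi : measurable_fun I (derive1 psi : lebesgueType R -> R).
  exact: continuous_measurable_leb.
have ivpsi : leb.-integrable `]a, b[ (EFin \o (fun x => v x * derive1 psi x)).
  apply: (@leb_bounded_integrable _ _ _ _ (V * Q)); first exact: measurable_funM.
  by move=> x xab; rewrite normrM ler_pM ?vV ?psiQ.
have igpsi : leb.-integrable `]a, b[ (EFin \o (fun x => g x * psi x)).
  apply: (@leb_bounded_integrable _ _ _ _ (G * P)); first exact: measurable_funM.
  by move=> x xab; rewrite normrM ler_pM ?gG ?psiP.
apply/eqP; rewrite -addr_eq0 -RintegralD//; apply/eqP.
have [V' phiV] := mollified_norm s ab node_ab.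
have [G' phiG] := derive1_mollified_norm n node s ab.
have := @leb_dominated_convergence R a b
  (fun m x => phi m x * derive1 psi x + derive1 (phi m) x * psi x)
  (fun x => v x * derive1 psi x + g x * psi x) (V' * Q + G' * P).
have -> : (fun m => (\int[leb]_(x in `]a, b[)
    (phi m x * derive1 psi x + derive1 (phi m) x * psi x))%R) = (fun=> 0 : R).
  apply/funext => m.
  have dphipsi x : is_derive x 1 (fun x => phi m x * psi x)
      (phi m x * derive1 psi x + derive1 (phi m) x * psi x).
    have h := smoothP x (smooth_mollified a b n node s m).
    have := is_deriveM h (is_dpsi x).
    by rewrite /GRing.scale/= [X in _ + X]mulrC.
  rewrite (leb_integral_derive ab dphipsi).
    have m0 : 0 < margin R m * (b - a) by rewrite mulr_gt0 ?margin_gt0// subr_gt0.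
    have phia : phi m a = 0 by apply: mollified_left => //; lra.
    have phib : phi m b = 0 by apply: mollified_right => //; lra.
    by rewrite phia phib !mul0r subrr.
  have cphi := smooth_continuous (smooth_mollified a b n node s m).
  have cdphi := smooth_continuous (smooth_derive (smooth_mollified a b n node s m)).
  by move=> x; exact: cvgD (cvgM (cphi x) (cdpsi x)) (cvgM (cdphi x) (cpsi x)).
move=> H; apply/esym.
suff lim0 : (fun=> 0 : R) @ \oo --> (\int[leb]_(x in `]a, b[)
    (v x * derive1 psi x + g x * psi x))%R.
  by apply: (cvg_unique _ _ lim0); [exact: norm_hausdorff|exact: cvg_cst].
apply: H.
- move=> m.
  exact: (measurable_funD (measurable_funM (mphi m) mdpsi) (measurable_funM (mdphi m) mpsi)).
- exact: (measurable_funD (measurable_funM mv mdpsi) (measurable_funM mg mpsi)).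
- move: ae_cvg; apply: (@filterS _ _ (ae_leb_filter R)) => x cx xab.
  have [c1 c2] := cx xab.
  exact: cvgD (cvgM c1 (cvg_cst _)) (cvgM c2 (cvg_cst _)).
- move=> m x xab; rewrite (le_trans (ler_normD _ _))// !normrM.
  by apply: lerD; apply: ler_pM; rewrite ?normr_ge0// ?phiV ?phiG ?psiP ?psiQ.
Qed.

(** Serves both halves of the H^1 norm: once for the functions, once for their derivatives. *)
Let cvg_L2 (f_ : nat -> R -> R) (f : R -> R) :
  (forall m, measurable_fun I (f_ m : lebesgueType R -> R)) ->
  measurable_fun I (f : lebesgueType R -> R) ->
  {ae (leb : set (lebesgueType R) -> \bar R), forall x, x \in `]a, b[ ->
     f_ m x @[m --> \oo] --> f x} ->
  (exists M : R, forall m x, x \in `]a, b[ -> `|f_ m x| <= M) ->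
  (exists M : R, forall x, x \in `]a, b[ -> `|f x| <= M) ->
  (\int[leb]_(x in `]a, b[) ((f x - f_ m x) ^+ 2))%R @[m --> \oo] --> (0 : R).
Proof.
move=> mf_ mf f_f [M f_M] [N fN].
have -> : (0 : R) = (\int[leb]_(x in `]a, b[) (fun=> 0) x)%R.
  by rewrite Rintegral_cst// mul0r.
apply: (@leb_dominated_convergence _ _ _ _ _ ((N + M) ^+ 2)).
- by move=> m; apply: measurable_funX; exact: measurable_funB.
- exact: measurable_cst.
- move: f_f; apply: (@filterS _ _ (ae_leb_filter R)) => x cx xab.
  have -> : (0 : R) = (f x - f x) * (f x - f x) by rewrite subrr mul0r.
  by under eq_cvg do rewrite expr2; apply: cvgM; apply: cvgB (cx xab); exact: cvg_cst.
- move=> m x xab; rewrite normrX lerXn2r ?nnegrE//.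
    by rewrite addr_ge0// (le_trans (normr_ge0 _) (fN _ xab),
      le_trans (normr_ge0 _) (f_M 0%N _ xab)).
  by rewrite (le_trans (ler_normB _ _))// lerD ?fN ?f_M.
Qed.

(** The Heaviside version [g] is the weak derivative, and the mollified functions are the
    approximating test functions. *)
Theorem H10_stitch : H10 `]a, b[ v.
Proof.
have gb : exists M : R, forall x, x \in `]a, b[ -> `|g x| <= M.
  by have [M gM] := g_norm; exists M.
exists g; split.
  by split; [exact: L2_bounded|exact: L2_bounded|exact: weak_derivative_stitch].
exists phi; split; first by move=> m; exact: test_function_mollified.
rewrite -[X in _ --> X](@sqrtr0 R); apply: continuous_cvg; first exact: sqrt_continuous.
rewrite -[X in _ --> X](addr0 0); apply: cvgD; apply: cvg_L2 => //.
- move: ae_cvg; apply: (@filterS _ _ (ae_leb_filter R)) => x cx xab.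
  by have [] := cx xab.
- exact: mollified_norm.
- move: ae_cvg; apply: (@filterS _ _ (ae_leb_filter R)) => x cx xab.
  by have [] := cx xab.
- by have [M HM] := derive1_mollified_norm n node s ab; exists M.
Qed.

End H10_stitch.

(** * Composition with a Caratheodory function *)

Section caratheodory_composition.
Variables (R : realType) (D : set (lebesgueType R)).
Hypothesis mD : measurable D.
Implicit Types (u : R -> R) (x : R).

Lemma measurable_patch (N : set (lebesgueType R)) (f : R -> R) (c : R) (E : set (lebesgueType R)) :
  measurable N -> measurable E -> measurable_fun E (f : lebesgueType R -> R) ->
  measurable_fun E ((fun x => if x \in N then c else f x) : lebesgueType R -> R).
Proof.
move=> mN mE mf; apply: measurable_fun_if; [exact: mE| |exact: measurable_cst|].
- apply: (measurable_fun_bool true).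
  rewrite (_ : _ @^-1` _ = N); first exact: measurableI.
  by apply/seteqP; split => x /=; [move/set_mem|move/mem_set].
- by apply: (measurable_funS mE _ mf); exact: subIsetl.
Qed.

Let floorN (m : nat) (t : R) : R := (Num.floor (m.+1%:R * t))%:~R / m.+1%:R.

Let cvg_floorN (t : R) : floorN m t @[m --> \oo] --> t.
Proof.
apply: (@squeeze_cvgr _ _ _ _ (fun m => t - harmonic m) (fun=> t)).
- apply: nearW => m; have m0 : 0 < m.+1%:R :> R by rewrite ltr0n.
  have := floor_itv (m.+1%:R * t); rewrite intrD => /andP[h1 h2].
  rewrite /floorN /harmonic; apply/andP; split.
    rewrite ler_pdivlMr// mulrBl mulVf ?gt_eqF//.
    by rewrite lerBlDr [t * _]mulrC ltW.
  by rewrite ler_pdivrMr// [t * _]mulrC.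
- rewrite -[X in _ --> X]subr0; apply: cvgB; [exact: cvg_cst|exact: cvg_harmonic].
- exact: cvg_cst.
Qed.

(* [kappa x (u x)] is the limit of its values along the countably valued
   roundings of [u]. *)
Lemma measurable_caratheodory (kappa : R -> R -> R) u (N : set (lebesgueType R)) (c : R) :
  measurable N ->
  (forall t, measurable_fun D ((fun x => kappa x t) : lebesgueType R -> R)) ->
  (forall x, D x -> x \notin N -> continuous (kappa x)) ->
  measurable_fun D (u : lebesgueType R -> R) ->
  measurable_fun D ((fun x => if x \in N then c else kappa x (u x)) : lebesgueType R -> R).
Proof.
move=> mN mk ck mu.
apply: (@measurable_fun_cvg _ _ _ D
  (fun m x => if x \in N then c else kappa x (floorN m (u x)))); last first.
  move=> x Dx; have [xN|xN] := boolP (x \in N); first exact: cvg_cst.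
  by apply: continuous_cvg; [exact: ck|exact: cvg_floorN].
move=> m; pose w x := m.+1%:R * u x.
have mw : measurable_fun D (w : lebesgueType R -> R).
  by apply: measurable_funM => //; exact: measurable_cst.
(* The level sets of the floor of [w], enumerated through a coding of the integers; indices that
   code no integer give the empty set. *)
pose E i : set (lebesgueType R) := if @unpickle int i is Some z
  then D `&` w @^-1` `[z%:~R, z%:~R + 1[%classic else set0.
have mE i : measurable (E i).
  rewrite /E; case: unpickle => [z|]; last exact: measurable0.
  by apply: mw => //; exact: measurable_itv.
have -> : D = \bigcup_i E i.
  apply/seteqP; split => x /=.
    move=> Dx; exists (pickle (Num.floor (w x))); first exact: I.
    rewrite /E pickleK; split => //=; rewrite in_itv/=.
    by have := floor_itv (w x); rewrite intrD.
  by case=> i _; rewrite /E; case: unpickle => // z [].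
apply/(measurable_fun_bigcup _ mE) => i.
move: (mE i); rewrite /E; case: unpickle => [z|] mEi; last exact: measurable_fun_set0.
(* On one level set the rounding of [u] is constant, so only measurability of [kappa] at a fixed
   second argument is involved. *)
have mconst : measurable_fun (D `&` w @^-1` `[z%:~R, z%:~R + 1[%classic)
    ((fun x => if x \in N then c else kappa x (z%:~R / m.+1%:R)) : lebesgueType R -> R).
  apply: (measurable_patch _ mN mEi).
  by apply: (measurable_funS mD _ (mk _)); exact: subIsetl.
apply: eq_measurable_fun mconst => x.
rewrite inE /= => -[_]; rewrite in_itv/= => zw.
by rewrite /floorN (@floor_def _ _ z)// intrD.
Qed.

End caratheodory_composition.

(** * Finite elements *)

Section cells.
Variables (R : realType) (a b : R) (n : nat) (node : nat -> R).
Hypothesis hnode : subdivision a b n node.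
Implicit Types (u : R -> R) (x : R) (j k : nat).

Definition slope (z : nat -> R) k := (z k.+1 - z k) / (node k.+1 - node k).

Lemma node_lt j k : (j < k)%N -> (k <= n)%N -> node j < node k.
Proof.
case: hnode => _ _ hn; elim: k => // k IH; rewrite ltnS leq_eqVlt => /orP[/eqP ->|jk] kn.
  exact: hn.
by apply: lt_trans (hn _ kn); apply: IH => //; exact: ltnW.
Qed.

Lemma node_le j k : (j <= k)%N -> (k <= n)%N -> node j <= node k.
Proof.
by rewrite leq_eqVlt => /orP[/eqP ->//|jk] kn; exact/ltW/node_lt.
Qed.

Lemma node_itv k : (k <= n)%N -> a <= node k <= b.
Proof. by case: (hnode) => <- <- _ kn; rewrite !node_le. Qed.

Lemma cell_sub k x : (k < n)%N -> x \in `]node k, node k.+1[ -> x \in `]a, b[.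
Proof.
move=> kn; rewrite !in_itv/= => /andP[kx xk].
have /andP[ak _] := node_itv (ltnW kn); have /andP[_ kb] := node_itv kn.
by rewrite (le_lt_trans ak kx) (lt_le_trans xk kb).
Qed.

Lemma find_cell x : x \in `]a, b[ ->
  exists2 k, (k < n)%N & node k <= x <= node k.+1.
Proof.
case: (hnode) => <- <- _; rewrite in_itv/= => /andP[ax xb].
have : x < node n by [].
suff H j : (j <= n)%N -> x < node j ->
  exists2 k, (k < n)%N & node k <= x <= node k.+1 by exact: H.
elim: j => [_|j IH jn xj]; first by rewrite ltNge (ltW ax).
have [xj'|jx] := ltP x (node j); first by apply: IH => //; exact: ltnW.
by exists j => //; rewrite jx ltW.
Qed.

Lemma slope_mul z k : (k < n)%N -> slope z k * (node k.+1 - node k) = z k.+1 - z k.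
Proof. by move=> kn; rewrite divfK// subr_eq0 gt_eqF// node_lt. Qed.

(** The affine formula is given on the open cell only; one-sided continuity extends it to both end
    nodes, whose values then determine its coefficients. *)
Lemma V0_cell u k x : V0 a b n node u -> (k < n)%N ->
  x \in `[node k, node k.+1] -> u x = u (node k) + slope (u \o node) k * (x - node k).
Proof.
move=> [cu /(_ k) aff _ _] kn; have {aff} [c [d aff]] := aff kn.
have kk : node k < node k.+1 by exact: node_lt.
have sub : `[node k, node k.+1] `<=` `[a, b].
  move=> y /=; rewrite !in_itv/= => /andP[ky yk].
  have /andP[ak _] := node_itv (ltnW kn); have /andP[_ kb] := node_itv kn.
  by rewrite (le_trans ak ky) (le_trans yk kb).
have /(continuous_within_itvP _ kk)[_ cl cr] := continuous_subspaceW sub cu.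
have caff t : c * y + d @[y --> t] --> c * t + d.
  apply: cvgD; last exact: cvg_cst.
  by apply: cvgM; [exact: cvg_cst|exact: cvg_id].
have uk : u (node k) = c * node k + d.
  apply: (cvg_unique _ cl) => //.
  apply: (@cvg_trans _ (c * y + d @[y --> (node k)^'+])).
    apply: near_eq_cvg; near=> y; rewrite aff// in_itv/=; apply/andP; split; near: y.
      exact: nbhs_right_gt.
    exact: nbhs_right_lt.
  by apply: cvg_at_right_filter; exact: caff.
have uk1 : u (node k.+1) = c * node k.+1 + d.
  apply: (cvg_unique _ cr) => //.
  apply: (@cvg_trans _ (c * y + d @[y --> (node k.+1)^'-])).
    apply: near_eq_cvg; near=> y; rewrite aff// in_itv/=; apply/andP; split; near: y.
      exact: nbhs_left_gt.
    exact: nbhs_left_lt.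
  by apply: cvg_at_left_filter; exact: caff.
have uaff y : y \in `[node k, node k.+1] -> u y = c * y + d.
  rewrite in_itv/= => /andP[]; rewrite le_eqVlt => /orP[/eqP <- _//|ky].
  rewrite le_eqVlt => /orP[/eqP ->//|yk].
  by apply: aff; rewrite in_itv/= ky yk.
move=> xk; rewrite uaff// uk /slope/= uk uk1.
have h0 : node k.+1 - node k != 0 by rewrite subr_eq0 gt_eqF.
have -> : c * node k.+1 + d - (c * node k + d) = c * (node k.+1 - node k) by ring.
by rewrite mulfK//; ring.
Unshelve. all: by end_near. Qed.

Lemma derive1_V0 u k x : V0 a b n node u -> (k < n)%N ->
  x \in `]node k, node k.+1[ -> derive1 u x = slope (u \o node) k.
Proof.
move=> Vu kn xk; rewrite derive1E.
set s := slope _ k.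
have daff : is_derive x 1 (fun y => u (node k) + s * (y - node k)) s.
  by apply: is_derive_eq; rewrite /GRing.scale/=; ring.
rewrite -[RHS](@derive_val _ _ _ _ _ _ _ daff); apply: near_eq_derive.
near=> y; rewrite (V0_cell Vu kn)//.
apply: subset_itv_oo_cc; near: y.
by apply: near_in_itvoo.
Unshelve. all: by end_near. Qed.

(** For cells to the left of [x] both Heaviside terms are 1, for cells to the right both are 0; only
    the k-th difference survives. *)
Lemma heaviside_cell (s : nat -> R) k x : (k < n)%N ->
  x \in `]node k, node k.+1[ -> stitch n s node (@heaviside R) x = s k.
Proof.
move=> kn; rewrite in_itv/= => /andP[kx xk].
rewrite /stitch (bigD1 (Ordinal kn))//= heaviside_gt0 ?subr_gt0//.
rewrite heaviside_le0 ?subr_le0 ?ltW// subr0 mulr1.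
rewrite big1 ?addr0// => j jk.
have [jltk|] := ltnP j k.
  rewrite !heaviside_gt0 ?subr_gt0 ?subrr ?mulr0//.
    by apply: le_lt_trans kx; apply: node_le => //; exact: ltnW.
  by apply: le_lt_trans kx; apply: node_le; [exact: ltnW|exact: ltnW].
rewrite leq_eqVlt => /orP[/eqP kj|kltj].
  by case/eqP: jk; apply: val_inj.
rewrite !heaviside_le0 ?subr_le0 ?subrr ?mulr0//.
  by apply: le_trans (ltW xk) _; apply: node_le => //; exact: ltnW.
by apply: le_trans (ltW xk) _; apply: node_le => //; exact: ltnW.
Qed.

End cells.

(** * Interpolation of nodal values *)

Section nodal_interpolant.
Variables (R : realType) (a b : R) (n : nat) (node : nat -> R).
Hypothesis hnode : subdivision a b n node.
Implicit Types (z : nat -> R) (x : R) (j k : nat).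

Definition interp z : R -> R := stitch n (slope node z) node (@ramp R).

Lemma interp_closed_up z : z 0%N = 0 -> z n = 0 ->
  \sum_(k < n) slope node z k * (node k.+1 - node k) = 0.
Proof.
move=> z0 zn; rewrite (eq_bigr (fun k : 'I_n => z k.+1 - z k)).
  by rewrite -(big_mkord xpredT (fun k => z k.+1 - z k)) telescope_sumr// z0 zn subrr.
by move=> k _; rewrite (slope_mul hnode).
Qed.

Lemma interp_node z j : z 0%N = 0 -> (j <= n)%N -> interp z (node j) = z j.
Proof.
move=> z0 jn; rewrite /interp /stitch.
rewrite (eq_bigr (fun k : 'I_n => if (k < j)%N then z k.+1 - z k else 0)).
  (* The cells to the left of [node j] contribute their full increments, the others nothing;
     [minn N j] lets the induction run past [j]. *)
  have telescope N : \sum_(k < N) (if (k < j)%N then z k.+1 - z k else 0) =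
      z (minn N j) - z 0%N.
    elim: N => [|N IH]; first by rewrite big_ord0 min0n subrr.
    rewrite big_ord_recr/= IH; have [Nj|jN] := ltnP N j.
      by rewrite (minn_idPl Nj); ring.
    by rewrite (minn_idPr (leqW jN)) addr0.
  by rewrite telescope z0 subr0 (minn_idPr jn).
move=> k _; have kn := ltn_ord k; case: ifPn => [kj|].
  rewrite !ramp_ge0 ?subr_ge0 ?(node_le hnode)//; last exact: ltnW.
  by rewrite -(slope_mul hnode)//; congr (_ * _); ring.
rewrite -leqNgt => jk; rewrite !ramp_le0 ?subrr ?mulr0// subr_le0 (node_le hnode)//.
  exact: leqW.
exact: ltnW.
Qed.

Lemma interp_V0 z : z 0%N = 0 -> z n = 0 -> V0 a b n node (interp z).
Proof.
move=> z0 zn; case: (hnode) => na nb _; split.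
- by apply: continuous_subspaceT; apply: continuous_stitch; exact: ramp_continuous.
(* [ge i] records whether [node i] lies at or to the left of [node j]. On the j-th cell each ramp is
   [ge i] times an affine function, whence the two coefficients. *)
- move=> j jn; pose ge i : R := (i <= j)%N%:R.
  exists (\sum_(k < n) slope node z k * (ge k - ge k.+1)).
  exists (\sum_(k < n) slope node z k * (ge k.+1 * node k.+1 - ge k * node k)).
  move=> x; rewrite in_itv/= => /andP[jx xj].
  have rampE k : (k <= n)%N -> ramp (x - node k) = ge k * (x - node k).
    move=> kn; rewrite /ge; case: (leqP k j) => [kj|jk].
      rewrite mul1r ramp_ge0// subr_ge0 (le_trans _ (ltW jx))//.
      by rewrite (node_le hnode)// ltnW.
    rewrite mul0r ramp_le0// subr_le0 (le_trans (ltW xj))//.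
    by rewrite (node_le hnode).
  rewrite /interp /stitch mulr_suml -big_split/=; apply: eq_bigr => k _.
  by rewrite !rampE ?(ltnW (ltn_ord k))//; ring.
- by rewrite -na interp_node.
- by rewrite -nb interp_node.
Qed.

Lemma interp_H10 z : a < b -> z 0%N = 0 -> z n = 0 -> H10 `]a, b[ (interp z).
Proof.
move=> ab z0 zn; apply: H10_stitch => //; last exact: interp_closed_up.
exact: node_itv hnode.
Qed.

(** On a cell [w] is a convex combination of its two nodal values. *)
Lemma V0_ge0 (w : R -> R) : V0 a b n node w ->
  (forall k, (k <= n)%N -> 0 <= w (node k)) -> forall x, x \in `]a, b[ -> 0 <= w x.
Proof.
move=> Vw w0 x /(find_cell hnode)[k kn kx].
have xk : x \in `[node k, node k.+1] by rewrite in_itv/=.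
rewrite (V0_cell hnode Vw kn xk) /slope/=.
have h0 : 0 < node k.+1 - node k by rewrite subr_gt0 (node_lt hnode).
have -> : w (node k) + (w (node k.+1) - w (node k)) / (node k.+1 - node k) * (x - node k)
  = (w (node k) * (node k.+1 - x) + w (node k.+1) * (x - node k)) / (node k.+1 - node k).
  by field; rewrite gt_eqF.
case/andP: kx => kx xk'.
by rewrite divr_ge0 ?(ltW h0)// addr_ge0// mulr_ge0 ?w0 ?subr_ge0// ltnW.
Qed.

Lemma V0B u v : V0 a b n node u -> V0 a b n node v -> V0 a b n node (fun x => u x - v x).
Proof.
move=> [cu au ua ub] [cv av va vb]; split.
- by move=> x; apply: cvgB; [exact: cu|exact: cv].
- move=> k kn; have [c [d uE]] := au _ kn; have [c' [d' vE]] := av _ kn.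
  by exists (c - c'), (d - d') => x xk; rewrite uE// vE//; ring.
- by rewrite ua va subrr.
- by rewrite ub vb subrr.
Qed.

End nodal_interpolant.

(** * Integrals over cells *)

Section cell_integrals.
Variable R : realType.
Implicit Types (F : R -> R) (p q : R).

Lemma Rintegral_affine p q (c d : R) : p < q ->
  (\int[leb]_(x in `]p, q[) (c * x + d))%R = (q - p) * (c * (p + q) / 2 + d).
Proof.
move=> pq; have dF (x : R) : is_derive x 1 (fun x => c / 2 * x ^+ 2 + d * x) (c * x + d).
  by apply: is_derive_eq; rewrite /GRing.scale/=; field.
rewrite (leb_integral_derive pq dF); first by field.
move=> x; apply: cvgD; last exact: cvg_cst.
by apply: cvgM; [exact: cvg_cst|exact: cvg_id].
Qed.

Lemma Rintegral_cells (a b : R) n node F : subdivision a b n node -> (0 < n)%N ->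
  leb.-integrable `]a, b[ (EFin \o F) ->
  (\int[leb]_(x in `]a, b[) F x =
   \sum_(k < n) \int[leb]_(x in `]node k, node k.+1[) F x)%R.
Proof.
move=> hnode; have [na nb _] := hnode; rewrite -nb -na.
(* Induction on the number of cells, starting from one; each further cell is attached at a single
   node, which is a null set. *)
suff H m : (m <= n)%N -> (0 < m)%N ->
    leb.-integrable `]node 0%N, node m[ (EFin \o F) ->
    (\int[leb]_(x in `]node 0%N, node m[) F x =
     \sum_(k < m) \int[leb]_(x in `]node k, node k.+1[) F x)%R.
  by move=> n0 iF; exact: H.
elim: m => // -[_ n1 _ iF|j IH jn _ iF]; first by rewrite big_ord1.
have lt0 : node 0%N < node j.+1 by apply: (node_lt hnode) => //; exact: ltnW.
have lt1 : node j.+1 < node j.+2 by exact: (node_lt hnode).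
have itvE : `]node 0%N, node j.+2[%classic =
    `]node 0%N, node j.+1[ `|` ([set node j.+1] `|` `]node j.+1, node j.+2[) :> set R.
  apply/seteqP; split => x /=; rewrite !in_itv/=.
    move=> /andP[x0 x2]; have [x1|x1|->] := ltgtP x (node j.+1).
    - by left; rewrite x0.
    - by right; right.
    - by right; left.
  case=> [/andP[-> x1]|[->|/andP[x1 ->]]].
  - exact: lt_trans x1 lt1.
  - by rewrite lt0.
  - by rewrite (lt_trans lt0 x1).
have mI (p q : R) : measurable (`]p, q[%classic : set (lebesgueType R)).
  exact: measurable_leb_itv.
have m1 : measurable ([set node j.+1] : set (lebesgueType R)) by exact: measurable_leb_set1.
have mI1 : measurable ([set node j.+1] `|` `]node j.+1, node j.+2[ : set (lebesgueType R)).
  exact: measurableU.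
have iFS (A : set (lebesgueType R)) : measurable A -> A `<=` `]node 0%N, node j.+2[%classic ->
    leb.-integrable A (EFin \o F).
  by move=> mA AI; exact: integrableS iF.
have iF' := iF; rewrite itvE in iF'.
rewrite itvE Rintegral_setU//; last first.
- apply/disj_setPS => x /= []; rewrite !in_itv/= => /andP[_ x1] [xE|/andP[x2 _]].
    by move: x1; rewrite xE ltxx.
  by move: (lt_trans x1 x2); rewrite ltxx.
have iF1 : leb.-integrable ([set node j.+1] `|` `]node j.+1, node j.+2[) (EFin \o F).
  by apply: iFS => //; rewrite itvE; exact: subsetUr.
rewrite Rintegral_setU//; last first.
  by apply/disj_setPS => x /= [->]; rewrite in_itv/= ltxx.
rewrite big_ord_recr/= IH ?(ltnW jn)//; last first.
  by apply: iFS => //; rewrite itvE; exact: subsetUl.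
congr (_ + _).
rewrite [X in X + _](_ : _ = 0) ?add0r//.
rewrite /Rintegral (null_set_integral m1 _ (leb_set1 _))//.
by have /integrableP[] : leb.-integrable [set node j.+1] (EFin \o F)
  by apply: iFS => //; rewrite itvE => x ->; right; left.
Qed.

End cell_integrals.

(** * The discrete equation with measurable representatives *)

Section discrete_form.
Variables (R : realType) (a b : R) (n : nat) (node : nat -> R).
Hypothesis hnode : subdivision a b n node.
Implicit Types (u v k : R -> R) (x : R).
Notation I := (`]a, b[%classic : set (lebesgueType R)).

(** Completeness of the measure makes [f] measurable along with [g]. *)
Lemma Rintegral_ae_eq (D : set (lebesgueType R)) (f g : R -> R) :
  measurable D -> measurable_fun D (g : lebesgueType R -> R) ->
  {ae (leb : set (lebesgueType R) -> \bar R), forall x, D x -> f x = g x} ->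
  (\int[leb]_(x in D) f x = \int[leb]_(x in D) g x)%R.
Proof.
move=> mD mg fg; have mg' : measurable_fun D (EFin \o g) by exact/measurable_EFinP.
have gf : ae_eq leb D (EFin \o g) (EFin \o f).
  by move: fg; apply: (@filterS _ _ (ae_leb_filter R)) => x fg Dx /=; rewrite fg.
have mf := @ae_measurable_fun _ _ R leb completed_lebesgue_measure_is_complete D _ _ gf mg'.
by rewrite /Rintegral; congr fine; apply/esym; exact: ae_eq_integral.
Qed.

(** A measurable, bounded stand-in for [derive1 u], which it equals off the nodes when [u] is in
    [V0]. *)
Definition dstep u : R -> R := stitch n (slope node (u \o node)) node (@heaviside R).

Lemma measurable_dstep u : measurable_fun I (dstep u : lebesgueType R -> R).
Proof.
apply: measurable_stitch; first exact: measurable_leb_itv.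
by apply: measurable_indic; exact: measurable_itv.
Qed.

Lemma dstep_bounded u : exists M : R, forall x, `|dstep u x| <= M.
Proof.
by eexists => x; apply: (@stitch_norm _ _ _ _ _ _ 1) => k _; exact: heaviside_norm.
Qed.

Lemma ae_derive1_V0 u : V0 a b n node u ->
  {ae (leb : set (lebesgueType R) -> \bar R),
     forall x, x \in `]a, b[ -> derive1 u x = dstep u x}.
Proof.
move=> Vu; apply: (@ae_leb_off_nodes _ n node) => x xnode /(find_cell hnode)[k kn].
rewrite le_eqVlt eq_sym (negbTE (xnode _ (ltnW kn)))/= => /andP[kx].
rewrite le_eqVlt (negbTE (xnode _ kn))/= => xk.
have xI : x \in `]node k, node k.+1[ by rewrite in_itv/= kx xk.
by rewrite (derive1_V0 hnode Vu kn xI) /dstep (heaviside_cell hnode _ kn xI).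
Qed.

Lemma discrete_form (kappa : R -> R -> R) u v k : V0 a b n node u -> V0 a b n node v ->
  measurable_fun I (k : lebesgueType R -> R) ->
  {ae (leb : set (lebesgueType R) -> \bar R),
     forall x, x \in `]a, b[ -> kappa x (u x) = k x} ->
  (\int[leb]_(x in `]a, b[) (kappa x (u x) * derive1 u x * derive1 v x) =
   \int[leb]_(x in `]a, b[) (k x * dstep u x * dstep v x))%R.
Proof.
move=> Vu Vv mk kE; apply: Rintegral_ae_eq; first exact: measurable_leb_itv.
  apply: measurable_funM; last exact: measurable_dstep.
  by apply: measurable_funM => //; exact: measurable_dstep.
have FF := ae_leb_filter R.
have H := @filterI _ _ FF _ _ kE
  (@filterI _ _ FF _ _ (ae_derive1_V0 Vu) (ae_derive1_V0 Vv)).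
apply: (@filterS _ _ FF _ _ _ H) => x [kx [ux vx]] xI.
by rewrite kx// ux// vx.
Qed.

Lemma integrable_dstep2 k u v (B : R) : measurable_fun I (k : lebesgueType R -> R) ->
  (forall x, x \in `]a, b[ -> `|k x| <= B) ->
  leb.-integrable `]a, b[ (EFin \o (fun x => k x * dstep u x * dstep v x)).
Proof.
move=> mk kB; have [M uM] := dstep_bounded u; have [N vN] := dstep_bounded v.
apply: (@leb_bounded_integrable _ _ _ _ (B * M * N)).
  apply: measurable_funM; last exact: measurable_dstep.
  by apply: measurable_funM => //; exact: measurable_dstep.
by move=> x xab; rewrite !normrM !ler_pM ?kB ?uM ?vN// mulr_ge0.
Qed.

End discrete_form.

(* On the null set where the structural conditions fail, the coefficient is
   replaced by the constant (ka + kb) / 2. *)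
Lemma everywhere_coefficients (R : realType) (a b : R) (kappa : R -> R -> R) (ka kb L0 : R)
    (u1 u2 : R -> R) :
  caratheodory_function `]a, b[ kappa -> ka < kb -> 0 < L0 ->
  {ae (leb : set (lebesgueType R) -> \bar R),
     forall x, x \in `]a, b[ -> forall s : R, ka < kappa x s < kb} ->
  {ae (leb : set (lebesgueType R) -> \bar R),
     forall x, x \in `]a, b[ -> forall s t : R,
       `|kappa x s - kappa x t| <= L0 * `|s - t|} ->
  measurable_fun (`]a, b[ : set (lebesgueType R)) (u1 : lebesgueType R -> R) ->
  measurable_fun (`]a, b[ : set (lebesgueType R)) (u2 : lebesgueType R -> R) ->
  exists k1 k2 : R -> R,
    [/\ measurable_fun (`]a, b[ : set (lebesgueType R)) (k1 : lebesgueType R -> R) /\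
        measurable_fun (`]a, b[ : set (lebesgueType R)) (k2 : lebesgueType R -> R),
        {ae (leb : set (lebesgueType R) -> \bar R), forall x, x \in `]a, b[ ->
           kappa x (u1 x) = k1 x},
        {ae (leb : set (lebesgueType R) -> \bar R), forall x, x \in `]a, b[ ->
           kappa x (u2 x) = k2 x},
        forall x, x \in `]a, b[ -> ka < k1 x < kb /\ ka < k2 x < kb &
        forall x, x \in `]a, b[ -> `|k1 x - k2 x| <= L0 * `|u1 x - u2 x|].
Proof.
move=> [mk ck] kab L0_gt0 hb hl mu1 mu2; have FF := ae_leb_filter R.
have [N [mN N0 NE]] := @filterI _ _ FF _ _ ck (@filterI _ _ FF _ _ hb hl).
have good x : x \notin N -> (x \in `]a, b[ -> continuous (kappa x)) /\
    (x \in `]a, b[ -> forall s : R, ka < kappa x s < kb) /\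
    (x \in `]a, b[ -> forall s t : R, `|kappa x s - kappa x t| <= L0 * `|s - t|).
  move=> xN; apply: contrapT => bad; move/negP: xN; apply; apply/mem_set/NE => /=.
  by move=> [h1 [h2 h3]]; apply: bad.
pose c := (ka + kb) / 2.
pose k (u : R -> R) x := if x \in N then c else kappa x (u x).
have mkk u : measurable_fun (`]a, b[ : set (lebesgueType R)) (u : lebesgueType R -> R) ->
    measurable_fun (`]a, b[ : set (lebesgueType R)) (k u : lebesgueType R -> R).
  move=> mu; apply: measurable_caratheodory => //; first exact: measurable_leb_itv.
  by move=> x xI /good[h _]; exact: h.
have aek (u : R -> R) : {ae (leb : set (lebesgueType R) -> \bar R), forall x, x \in `]a, b[ ->
    kappa x (u x) = k u x}.
  exists N; split => // x /= nx; apply: contrapT => xN; apply: nx => _.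
  by rewrite /k memNset.
have kb' u x : x \in `]a, b[ -> ka < k u x < kb.
  move=> xI; rewrite /k; case: ifPn => [_|/good[_ [h _]]]; last exact: h.
  by rewrite /c; apply/andP; split; lra.
exists (k u1), (k u2); split => //.
- by split; exact: mkk.
- by move=> x xI; split; exact: kb'.
- move=> x xI; rewrite /k; case: ifPn => [_|/good[_ [_ h]]]; last exact: h.
  by rewrite subrr normr0 mulr_ge0// ltW.
Qed.

Lemma V0_measurable (R : realType) (a b : R) n node (u : R -> R) :
  V0 a b n node u ->
  measurable_fun (`]a, b[ : set (lebesgueType R)) (u : lebesgueType R -> R).
Proof.
move=> [cu _ _ _]; apply: measurable_fun_leb; last exact: measurable_itv.
apply: (measurable_funS (E := `[a, b])).
- exact: measurable_itv.
- exact: subset_itv_oo_cc.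
- by apply: subspace_continuous_measurable_fun => //; exact: measurable_itv.
Qed.

(* On a cell where w changes sign the integrand dominates an affine function
   with positive mean. *)
Lemma cell_integral_gt0 (R : realType) (p q ka C al be : R) (F : R -> R) : p < q ->
  leb.-integrable `]p, q[ (EFin \o F) ->
  0 < al + be -> C * (q - p) < 2 * ka ->
  (forall x, x \in `]p, q[ ->
     ka * (al + be) / (q - p) ^+ 2
       - C * (al * (q - x) + be * (x - p)) / (q - p) ^+ 2 <= F x) ->
  0 < (\int[leb]_(x in `]p, q[) F x)%R.
Proof.
move=> pq iF ab0 Ch HF; have h0 : 0 < q - p by rewrite subr_gt0.
have h0' : q - p != 0 by rewrite gt_eqF.
pose c := - C * (be - al) / (q - p) ^+ 2.
pose d := ka * (al + be) / (q - p) ^+ 2 - C * (al * q - be * p) / (q - p) ^+ 2.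
have AE x : ka * (al + be) / (q - p) ^+ 2
    - C * (al * (q - x) + be * (x - p)) / (q - p) ^+ 2 = c * x + d.
  by rewrite /c /d; field.
apply: (@lt_le_trans _ _ (\int[leb]_(x in `]p, q[) (c * x + d))%R).
  rewrite Rintegral_affine//.
  (* The interpolant of [al] and [be] has mean (al + be) / 2; this is the origin of the factor 2 in
     the smallness condition. *)
  have -> : (q - p) * (c * (p + q) / 2 + d) =
      (al + be) * (2 * ka - C * (q - p)) / (2 * (q - p)).
    by rewrite /c /d; field.
  by rewrite divr_gt0 ?mulr_gt0// subr_gt0.
apply: le_Rintegral => //.
- exact: measurable_leb_itv.
- apply: (@leb_bounded_integrable _ _ _ _ (`|c| * (`|p| + `|q|) + `|d|)).
    apply: continuous_measurable_leb; first exact: measurable_leb_itv.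
    move=> x; apply: cvgD; last exact: cvg_cst.
    by apply: cvgM; [exact: cvg_cst|exact: cvg_id].
  move=> x; rewrite in_itv/= => /andP[px xq].
  rewrite (le_trans (ler_normD _ _))// lerD// normrM ler_wpM2l//.
  rewrite ler_norml; apply/andP; split.
    by have := ler_normr (- p) p; have := lerNnormlW (lexx `|p|); have := normr_ge0 q; lra.
  by have := ler_norm q; have := normr_ge0 p; lra.
- by move=> x xI; rewrite -AE; exact: HF.
Qed.

(** Here [P] and [Q] are the values of w at the ends of a cell of length [h], [s] and [t] the
    distances from x to the right and left ends, so that (P s + Q t) / h = w(x). [S] is the slope of
    u2 and [Z] the jump of the test function. The sign change enters as [(Q - P) * Z = |P| + |Q|];
    the first term is then bounded through [ka <= K1], the second through the Lipschitz estimate. *)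
Lemma sign_change_bound (R : realFieldType) (ka L0 K1 K2 S P Q h s t Z : R) :
  0 < h -> 0 <= s -> 0 <= t -> 0 <= L0 -> ka <= K1 -> `|Z| = 1 ->
  (Q - P) * Z = `|P| + `|Q| ->
  `|K1 - K2| <= L0 * `|(P * s + Q * t) / h| ->
  ka * (`|P| + `|Q|) / h ^+ 2 - L0 * `|S| * (`|P| * s + `|Q| * t) / h ^+ 2
    <= (K1 * ((Q - P) / h) + (K1 - K2) * S) * (Z / h).
Proof.
move=> h0 s0 t0 L0_ge0 kaK Z1 QPZ K12; have h0' : h != 0 by rewrite gt_eqF.
have -> : (K1 * ((Q - P) / h) + (K1 - K2) * S) * (Z / h) =
    K1 * ((Q - P) * Z) / h ^+ 2 + (K1 - K2) * S * Z / h by field.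
rewrite QPZ; apply: lerD.
  by rewrite ler_wpM2r ?invr_ge0 ?exprn_ge0 ?(ltW h0)// ler_wpM2r// addr_ge0.
rewrite lerNl (le_trans (ler_norm _))// normrN normrM normfV (gtr0_norm h0).
rewrite !normrM Z1 mulr1 expr2 invfM mulrA ler_wpM2r ?invr_ge0 ?(ltW h0)//.
have -> : L0 * `|S| * (`|P| * s + `|Q| * t) / h = L0 * ((`|P| * s + `|Q| * t) / h) * `|S|.
  by ring.
rewrite ler_wpM2r// (le_trans K12)// ler_wpM2l// normrM normfV (gtr0_norm h0).
rewrite ler_wpM2r ?invr_ge0 ?(ltW h0)// (le_trans (ler_normD _ _))//.
by rewrite !normrM (ger0_norm s0) (ger0_norm t0).
Qed.

Theorem theorem2p1 (R : realType) (a b : R) (hab : a < b)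
    (n : nat) (node : nat -> R) (hnode : subdivision a b n node)
    (kappa : R -> R -> R) (ka kb L0 : R)
    (hkappa : caratheodory_function `]a, b[ kappa)
    (hka : 0 < ka) (hkakb : ka < kb)
    (hbound : {ae (leb : set (lebesgueType R) -> \bar R),
       forall x, x \in `]a, b[ -> forall s : R, ka < kappa x s < kb})
    (hL0 : 0 < L0)
    (hlip : {ae (leb : set (lebesgueType R) -> \bar R),
       forall x, x \in `]a, b[ -> forall s t : R,
         `|kappa x s - kappa x t| <= L0 * `|s - t|})
    (f1 f2 : (R -> R) -> R)
    (hf1 : Hm1 `]a, b[ f1) (hf2 : Hm1 `]a, b[ f2)
    (hf : Hm1_le `]a, b[ f1 f2)
    (u1 u2 : R -> R)
    (hu1 : discrete_solution a b n node kappa f1 u1)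
    (hu2 : discrete_solution a b n node kappa f2 u2)
    (hmax : \big[Num.max/0]_(k < n) `|u2 (node k) - u2 (node k.+1)|
              < 2 * ka / L0) :
  forall x, x \in `]a, b[ -> u1 x <= u2 x.
Proof.
have [V1 eq1] := hu1; have [V2 eq2] := hu2.
pose w x := u1 x - u2 x.
have Vw : V0 a b n node w by exact: V0B.
have jump k : (k < n)%N -> L0 * `|u2 (node k.+1) - u2 (node k)| < 2 * ka.
  move=> kn; rewrite mulrC -ltr_pdivlMr// distrC; apply: le_lt_trans hmax.
  exact: (le_bigmax _ (fun k : 'I_n => `|u2 (node k) - u2 (node k.+1)|) (Ordinal kn)).
suff nodal k : (k <= n)%N -> w (node k) <= 0.
  move=> x xI; rewrite -subr_ge0.
  apply: (V0_ge0 hnode (V0B V2 V1)) => // k kn.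
  by have := nodal k kn; rewrite /w; lra.
move=> kn; rewrite leNgt; apply/negP => wk.
pose z k : R := (0 < w (node k))%R%:R.
have [na nb _] := hnode; have [_ _ wa wb] := Vw.
(* Positivity in [z] is strict, so the boundary values w(a) = w(b) = 0 yield 0. *)
have z0 : z 0%N = 0 by rewrite /z na wa ltxx.
have zn : z n = 0 by rewrite /z nb wb ltxx.
have n_gt0 : (0 < n)%N.
  by rewrite lt0n; apply: contraTneq hab => n0; rewrite -na -nb n0 ltxx.
pose v := interp n node z.
have Vv : V0 a b n node v by exact: interp_V0.
have v_node j : (j <= n)%N -> v (node j) = z j by exact: (interp_node hnode).
have v_ge0 x : x \in `]a, b[ -> 0 <= v x.
  by apply: (V0_ge0 hnode Vv) => j jn; rewrite v_node// /z ler0n.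
have f12 : f1 v <= f2 v.
  apply: hf; first exact: interp_H10.
  by apply: aeW => x xI; exact: v_ge0.
have [k1 [k2 [[mk1 mk2] ae1 ae2 k12 k12L]]] :=
  everywhere_coefficients hkappa hkakb hL0 hbound hlip (V0_measurable V1) (V0_measurable V2).
have k_norm x : x \in `]a, b[ -> `|k1 x| <= kb /\ `|k2 x| <= kb.
  move=> /k12[/andP[h1 h2] /andP[h3 h4]].
  by split; rewrite ger0_norm ?ltW// (lt_trans hka).
have i1 := integrable_dstep2 n node u1 v mk1 (fun x xI => (k_norm x xI).1).
have i2 := integrable_dstep2 n node u2 v mk2 (fun x xI => (k_norm x xI).2).
pose G x := k1 x * dstep n node u1 x * dstep n node v x
            - k2 x * dstep n node u2 x * dstep n node v x.
have iG : leb.-integrable `]a, b[ (EFin \o G).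
  exact: (integrableB (measurable_leb_itv _) i1 i2).
have : (\int[leb]_(x in `]a, b[) G x)%R <= 0.
  rewrite RintegralB//; last exact: measurable_leb_itv.
  rewrite -(discrete_form hnode V1 Vv mk1 ae1) -(discrete_form hnode V2 Vv mk2 ae2).
  by rewrite eq1// eq2// subr_le0.
(* The contradiction: cell by cell, the same integral turns out to be positive. *)
apply/negP; rewrite -ltNge (Rintegral_cells hnode n_gt0 iG).
have GE j x : (j < n)%N -> x \in `]node j, node j.+1[ ->
    G x = (k1 x * (slope node (w \o node) j) + (k1 x - k2 x) * slope node (u2 \o node) j)
          * slope node z j.
  move=> jn xj; rewrite /G /dstep !(heaviside_cell hnode _ jn xj).
  have -> : slope node (v \o node) j = slope node z j.
    by rewrite /slope/= !v_node// ltnW.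
  have -> : slope node (u1 \o node) j =
      slope node (w \o node) j + slope node (u2 \o node) j.
    by rewrite /slope/= /w -mulrDl; congr (_ / _); ring.
  by ring.
have cell_eq0 j : (j < n)%N -> z j = z j.+1 ->
    (\int[leb]_(x in `]node j, node j.+1[) G x)%R = 0.
  move=> jn zj; rewrite (@eq_Rintegral _ _ _ _ _ (fun=> 0)).
    by rewrite Rintegral_cst ?mul0r//; exact: measurable_leb_itv.
  move=> x; rewrite inE/= => xj.
  by rewrite (GE j)// /slope zj subrr mul0r mulr0.
have cell_gt0 j : (j < n)%N -> z j != z j.+1 ->
    0 < (\int[leb]_(x in `]node j, node j.+1[) G x)%R.
  move=> jn zj.
  have h0 : 0 < node j.+1 - node j by rewrite subr_gt0 (node_lt hnode).
  (* Exactly one of the two nodal values of [w] is positive, so [w] and [z] jump in the same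
     direction, and the jump of [w] has size equal to the sum of the absolute values. *)
  have [Z1 zw ww] : [/\ `|z j.+1 - z j| = 1,
      (w (node j.+1) - w (node j)) * (z j.+1 - z j) =
        `|w (node j)| + `|w (node j.+1)| &
      0 < `|w (node j)| + `|w (node j.+1)|].
    move: zj; rewrite /z.
    have [P0|P0] := ltP 0 (w (node j)); have [Q0|Q0] := ltP 0 (w (node j.+1));
      rewrite ?eqxx//= => _.
    - rewrite sub0r normrN normr1 (gtr0_norm P0) (ler0_norm Q0).
      by split; [by []|ring|lra].
    - rewrite subr0 normr1 (gtr0_norm Q0) (ler0_norm P0).
      by split; [by []|ring|lra].
  (* With this constant, [C * (q - p)] is [L0] times the jump of [u2] across the cell, which [jump]
     bounds by [2 * ka]. *)
  apply: (@cell_integral_gt0 _ _ _ ka (L0 * `|slope node (u2 \o node) j|)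
    `|w (node j)| `|w (node j.+1)|).
  - exact: (node_lt hnode).
  - apply: integrableS iG; [exact: measurable_leb_itv|exact: measurable_leb_itv|].
    by move=> x; exact: (cell_sub hnode).
  - exact: ww.
  - rewrite -mulrA /slope normrM normfV [X in _ * X^-1]gtr0_norm// divfK ?gt_eqF//=.
    exact: jump.
  - move=> x xj; rewrite (GE j)//.
    have xI := cell_sub hnode jn xj.
    have [/andP[/ltW kaK _] _] := k12 x xI.
    have := xj; rewrite in_itv/= => /andP[/ltW px /ltW xq].
    apply: sign_change_bound => //; rewrite ?subr_ge0// ?(ltW hL0)//.
    rewrite (le_trans (k12L x xI))// -/(w x) (V0_cell hnode Vw jn).
      rewrite /slope/= ler_wpM2l ?(ltW hL0)// le_eqVlt; apply/orP; left; apply/eqP.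
      by congr `|_|; field; rewrite gt_eqF.
    exact: subset_itv_oo_cc.
(* Without such a cell [z] would keep its initial value 0 up to index [k], where it is 1. *)
have [j jn zj] : exists2 j, (j < n)%N & z j != z j.+1.
  apply: contrapT => nj; have zeq m : (m <= n)%N -> z m = 0.
    elim: m => // m IH mn; have [<-|zm] := eqVneq (z m) (z m.+1); last by case: nj; exists m.
    by apply: IH; exact: ltnW.
  by move: (zeq k kn); rewrite /z wk => /eqP; rewrite oner_eq0.
rewrite (bigD1 (Ordinal jn))//= ltr_pwDl ?cell_gt0//.
apply: sumr_ge0 => i _; have [zi|zi] := eqVneq (z i) (z i.+1).
  by rewrite cell_eq0.
by rewrite ltW// cell_gt0.
Qed.
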